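(* Let $\Theta\subset\mathbb{R}^p$ and $\alpha\in(0,1)$, and let $\chi^2_{p,1-\alpha}$ be the $(1-\alpha)$-quantile of the chi-squared distribution with $p$ degrees of freedom. Assume the regularity conditions (A1)–(A6) listed in the context. Let $\breve\theta_{n,PV}$ be any solution $\theta$ of the pivot equality $$n\Big[\frac1n\sum_{i=1}^n l_\theta(y_i;\theta)\Big]^T B_n(\theta)^{-1}\Big[\frac1n\sum_{i=1}^n l_\theta(y_i;\theta)\Big]=\chi^2_{p,1-\alpha},$$ and let $\breve\theta_{n,SW}$ be the corresponding solution $\theta$ of the sandwich equality $$n(\hat\theta_n-\theta)^T A_n(\hat\theta_n)B_n(\hat\theta_n)^{-1}A_n(\hat\theta_n)(\hat\theta_n-\theta)=\chi^2_{p,1-\alpha}$$ lying in the same direction from $\hat\theta_n$ as $\breve\theta_{n,PV}$, i.e. $\breve\theta_{n,SW}-\hat\theta_n$ is a positive multiple of $\breve\theta_{n,PV}-\hat\theta_n$. Then $$\sqrt n\,\|\breve\theta_{n,PV}-\breve\theta_{n,SW}\|\to0\quad\text{almost surely as } n\to\infty .$$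
   Context: Setting (possibly misspecified likelihood, $p$-dimensional parameter). The data $y_1,y_2,\dots$ are i.i.d. with true density $g$; the working model is a family of densities $\{f(y;\theta):\theta\in\Theta\}$, $\Theta\subset\mathbb{R}^p$, and $g$ need not belong to it. All expectations $E$ are with respect to $g$. Write $l(y;\theta)=\log f(y;\theta)$, $l_\theta$ for its gradient (a column vector) and $l_{\theta\theta}$ for its Hessian in $\theta$. Define the $p\times p$ matrices $$A_n(\theta)=-\frac1n\sum_{i=1}^n l_{\theta\theta}(y_i;\theta),\quad A(\theta)=-E[l_{\theta\theta}(y;\theta)],\quad B_n(\theta)=\frac1n\sum_{i=1}^n l_\theta(y_i;\theta)l_\theta(y_i;\theta)^T,\quad B(\theta)=E[l_\theta(y;\theta)l_\theta(y;\theta)^T].$$ $\hat\theta_n$ is a maximizer of $\sum_{i=1}^n l(y_i;\theta)$ over $\Theta$ (the maximum misspecified likelihood estimator). $\theta^*$ is the pseudo-true parameter, i.e. the minimizer over $\Theta$ of the Kullback–Leibler divergence $E[\log g(y)-\log f(y;\theta)]$. $\|\cdot\|$ is the Euclidean norm. Regularity conditions (White, 1982): (A1) the $y_i$ are i.i.d. with a measurable density $g$ with respect to a dominating measure $\nu$ on a measurable Euclidean space; (A2) the densities $f(y;\theta)$ (with respect to $\nu$) are measurable in $y$ for each $\theta\in\Theta$ and continuous in $\theta$ for each $y$, and $\Theta$ is compact; (A3) $E[\log g(y)]$ exists, $|\log f(y;\theta)|\le m(y)$ for all $\theta\in\Theta$ with $m$ integrable under $g$, and the Kullback–Leibler divergence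 has a unique minimizer $\theta^*\in\Theta$; (A4) the components of $l_\theta(y;\theta)$ are measurable in $y$ for each $\theta$ and continuously differentiable in $\theta$ for each $y$; (A5) the absolute values of all entries of $l_{\theta\theta}(y;\theta)$ and of $l_\theta(y;\theta)l_\theta(y;\theta)^T$ are bounded, for all $\theta\in\Theta$, by functions of $y$ that are integrable under $g$; (A6) $\theta^*$ is interior to $\Theta$, $B(\theta^* )$ is nonsingular, and $\theta^*$ is a regular point of $A(\theta)$ (constant rank in an open neighborhood of $\theta^*$); moreover $A(\theta^* )$ has full rank.
   Formalization: ''Any solution'' is false under (A1)–(A6): pivot solutions can cluster at other stationary points of the KL divergence. Added: the pivot solutions lie in Θ and, a.s. for large n, in a closed set K where θ* is the only zero of E[l_θ(y;θ)] over Θ. *)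

(* Defs.v *)
From HB Require Import structures.
From mathcomp Require Import all_boot all_order all_algebra finmap.
From mathcomp Require Import all_classical all_reals all_analysis.

Set Implicit Arguments.
Unset Strict Implicit.
Unset Printing Implicit Defensive.

Import Order.TTheory GRing.Theory Num.Theory.
Import numFieldNormedType.Exports.

Local Open Scope classical_set_scope.
Local Open Scope ring_scope.

(* The topology of 'cV[R]_p is the usual one of R^p, but the library norm `|v|
   is the sup norm, whence this definition. *)
Definition enorm (R : realType) (p : nat) (v : 'cV[R]_p) : R :=
  Num.sqrt (\sum_(i < p) v i 0 ^+ 2).

Definition mutually_independent (R : realType) (d d' : measure_display)
    (Om : measurableType d) (P : probability Om R) (T : measurableType d')
    (Y : nat -> {RV P >-> T}) : Prop :=
  forall (J : {fset nat}) (B : nat -> set T), (forall i, measurable (B i)) ->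
    P (\bigcap_(i in [set` J]) (Y i @^-1` B i)) =
    (\prod_(i <- enum_fset J) P (Y i @^-1` B i))%E.

(* "phi is integrable under g" and "E[phi(y)]", where g is the true density
   with respect to the dominating measure nu. *)
Definition integrable_under (R : realType) (d : measure_display)
    (T : measurableType d) (nu : {measure set T -> \bar R}) (g : T -> R)
    (phi : T -> R) : Prop :=
  measurable_fun setT phi /\
  nu.-integrable setT (fun y => (phi y * g y)%:E).

Definition expect (R : realType) (d : measure_display)
    (T : measurableType d) (nu : {measure set T -> \bar R}) (g : T -> R)
    (phi : T -> R) : R :=
  \int[nu]_(y in setT) (phi y * g y).

(* A model is a function f : T -> 'cV[R]_p -> R, read as f(y; theta); only its
   restriction to Theta is statistically meaningful.  It is a total function so
   that derivatives can be taken at boundary points of Theta (see [cond_A4]). *)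
Definition loglik (R : realType) (p : nat) (T : Type)
    (f : T -> 'cV[R]_p -> R) (y : T) (theta : 'cV[R]_p) : R :=
  ln (f y theta).

Definition score (R : realType) (p : nat) (T : Type)
    (f : T -> 'cV[R]_p -> R) (y : T) (theta : 'cV[R]_p) : 'cV[R]_p :=
  \col_i 'D_(delta_mx i 0) (loglik f y) theta.

Definition hessian (R : realType) (p : nat) (T : Type)
    (f : T -> 'cV[R]_p -> R) (y : T) (theta : 'cV[R]_p) : 'M[R]_p :=
  \matrix_(i, j) 'D_(delta_mx j 0) (fun t => score f y t i 0) theta.

Definition score_outer (R : realType) (p : nat) (T : Type)
    (f : T -> 'cV[R]_p -> R) (y : T) (theta : 'cV[R]_p) : 'M[R]_p :=
  score f y theta *m (score f y theta)^T.

(* Empirical quantities: the observations are y 0, ..., y (n - 1). *)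
Definition mean_score (R : realType) (p : nat) (T : Type)
    (f : T -> 'cV[R]_p -> R) (y : nat -> T) (n : nat) (theta : 'cV[R]_p) :
    'cV[R]_p :=
  n%:R^-1 *: \sum_(i < n) score f (y i) theta.

Definition A_emp (R : realType) (p : nat) (T : Type)
    (f : T -> 'cV[R]_p -> R) (y : nat -> T) (n : nat) (theta : 'cV[R]_p) :
    'M[R]_p :=
  - (n%:R^-1 *: \sum_(i < n) hessian f (y i) theta).

Definition B_emp (R : realType) (p : nat) (T : Type)
    (f : T -> 'cV[R]_p -> R) (y : nat -> T) (n : nat) (theta : 'cV[R]_p) :
    'M[R]_p :=
  n%:R^-1 *: \sum_(i < n) score_outer f (y i) theta.

Definition A_pop (R : realType) (p : nat) (d : measure_display)
    (T : measurableType d) (nu : {measure set T -> \bar R}) (g : T -> R)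
    (f : T -> 'cV[R]_p -> R) (theta : 'cV[R]_p) : 'M[R]_p :=
  - (\matrix_(i, j) expect nu g (fun y => hessian f y theta i j)).

Definition B_pop (R : realType) (p : nat) (d : measure_display)
    (T : measurableType d) (nu : {measure set T -> \bar R}) (g : T -> R)
    (f : T -> 'cV[R]_p -> R) (theta : 'cV[R]_p) : 'M[R]_p :=
  \matrix_(i, j) expect nu g (fun y => score_outer f y theta i j).

Definition score_pop (R : realType) (p : nat) (d : measure_display)
    (T : measurableType d) (nu : {measure set T -> \bar R}) (g : T -> R)
    (f : T -> 'cV[R]_p -> R) (theta : 'cV[R]_p) : 'cV[R]_p :=
  \col_i expect nu g (fun y => score f y theta i 0).

Definition KL (R : realType) (p : nat) (d : measure_display)
    (T : measurableType d) (nu : {measure set T -> \bar R}) (g : T -> R)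
    (f : T -> 'cV[R]_p -> R) (theta : 'cV[R]_p) : R :=
  expect nu g (fun y => ln (g y) - loglik f y theta).

(* The sample space T may be any measurable space; a measurable Euclidean space
   is a special case. *)
Definition cond_A1 (R : realType) (d d' : measure_display)
    (Om : measurableType d) (P : probability Om R) (T : measurableType d')
    (Y : nat -> {RV P >-> T}) (nu : {measure set T -> \bar R}) (g : T -> R) :
    Prop :=
  [/\ mutually_independent Y,
      measurable_fun setT g,
      (forall y, 0 <= g y) &
      (forall (n : nat) (B : set T), measurable B ->
         P (Y n @^-1` B) = (\int[nu]_(y in B) (g y)%:E)%E)].

Definition cond_A2 (R : realType) (p : nat) (d : measure_display)
    (T : measurableType d) (nu : {measure set T -> \bar R})
    (Theta : set 'cV[R]_p) (f : T -> 'cV[R]_p -> R) : Prop :=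
  [/\ compact Theta,
      (forall theta, Theta theta ->
         [/\ forall y, 0 <= f y theta,
             measurable_fun setT (f ^~ theta) &
             (\int[nu]_(y in setT) (f y theta)%:E)%E = 1%E]) &
      (forall y, {within Theta, continuous (f y)})].

(* A real bound on |log f| forces f > 0; this has to be said because
   ln x = 0 for x <= 0 in the library.  The same convention makes the points
   where g vanishes contribute 0 to E[log g]. *)
Definition cond_A3 (R : realType) (p : nat) (d : measure_display)
    (T : measurableType d) (nu : {measure set T -> \bar R}) (g : T -> R)
    (Theta : set 'cV[R]_p) (f : T -> 'cV[R]_p -> R) (theta0 : 'cV[R]_p) :
    Prop :=
  [/\ integrable_under nu g (fun y => ln (g y)),
      (exists2 m : T -> R, integrable_under nu g m &
         forall y theta, Theta theta ->
           0 < f y theta /\ `|loglik f y theta| <= m y),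
      Theta theta0 &
      (forall theta, Theta theta -> theta <> theta0 ->
         KL nu g f theta0 < KL nu g f theta)].

(* Theta is an arbitrary compact set, so smoothness "on Theta" is read as
   smoothness in a neighbourhood of each point of Theta. *)
Definition cond_A4 (R : realType) (p : nat) (d : measure_display)
    (T : measurableType d) (Theta : set 'cV[R]_p)
    (f : T -> 'cV[R]_p -> R) : Prop :=
  (forall theta, Theta theta -> forall i,
     measurable_fun setT (fun y => score f y theta i 0)) /\
  (forall y theta, Theta theta -> \forall t \near theta,
     [/\ differentiable (loglik f y) t,
         (forall i, differentiable (fun u => score f y u i 0) t) &
         (forall i j, {for t, continuous (fun u => hessian f y u i j)})]).

Definition cond_A5 (R : realType) (p : nat) (d : measure_display)
    (T : measurableType d) (nu : {measure set T -> \bar R}) (g : T -> R)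
    (Theta : set 'cV[R]_p) (f : T -> 'cV[R]_p -> R) : Prop :=
  forall i j,
    (exists2 h : T -> R, integrable_under nu g h &
       forall y theta, Theta theta -> `|hessian f y theta i j| <= h y) /\
    (exists2 h : T -> R, integrable_under nu g h &
       forall y theta, Theta theta -> `|score_outer f y theta i j| <= h y).

Definition cond_A6 (R : realType) (p : nat) (d : measure_display)
    (T : measurableType d) (nu : {measure set T -> \bar R}) (g : T -> R)
    (Theta : set 'cV[R]_p) (f : T -> 'cV[R]_p -> R) (theta0 : 'cV[R]_p) :
    Prop :=
  [/\ Theta° theta0,
      B_pop nu g f theta0 \in unitmx,
      (\forall theta \near theta0,
         \rank (A_pop nu g f theta) = \rank (A_pop nu g f theta0)) &
      \rank (A_pop nu g f theta0) = p].

Definition gamma_fun (R : realType) (a : R) : R :=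
  \int[@lebesgue_measure R]_(t in `]0, +oo[) (t `^ (a - 1) * expR (- t)).

Definition chi2_pdf (R : realType) (p : nat) (t : R) : R :=
  t `^ (p%:R / 2 - 1) * expR (- t / 2) /
  (2 `^ (p%:R / 2) * gamma_fun (p%:R / 2)).

Definition chi2_cdf (R : realType) (p : nat) (x : R) : R :=
  \int[@lebesgue_measure R]_(t in `]0, x]) chi2_pdf p t.

Definition chi2_quantile (R : realType) (p : nat) (u : R) : R :=
  inf [set x : R | u <= chi2_cdf p x].

Definition is_mle (R : realType) (p : nat) (T : Type) (Theta : set 'cV[R]_p)
    (f : T -> 'cV[R]_p -> R) (y : nat -> T) (n : nat) (that : 'cV[R]_p) :
    Prop :=
  Theta that /\
  forall theta, Theta theta ->
    \sum_(i < n) loglik f (y i) theta <= \sum_(i < n) loglik f (y i) that.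

(* [invmx] of a singular matrix is the matrix itself, so the existence of the
   inverse is part of the meaning of the two equalities below. *)
Definition pivot_solution (R : realType) (p : nat) (T : Type)
    (Theta : set 'cV[R]_p) (f : T -> 'cV[R]_p -> R) (c : R) (y : nat -> T)
    (n : nat) (theta : 'cV[R]_p) : Prop :=
  [/\ Theta theta,
      B_emp f y n theta \in unitmx &
      n%:R * ((mean_score f y n theta)^T *m invmx (B_emp f y n theta)
              *m mean_score f y n theta) 0 0 = c].

Definition sandwich_solution (R : realType) (p : nat) (T : Type)
    (f : T -> 'cV[R]_p -> R) (c : R) (y : nat -> T) (n : nat)
    (that theta : 'cV[R]_p) : Prop :=
  B_emp f y n that \in unitmx /\
  n%:R * ((that - theta)^T *m A_emp f y n that *m invmx (B_emp f y n that)
          *m A_emp f y n that *m (that - theta)) 0 0 = c.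

Definition same_direction (R : realType) (p : nat) (that u v : 'cV[R]_p) :
    Prop :=
  exists2 t : R, 0 < t & v - that = t *: (u - that).

(* Conditions A1-A6 do not prevent E[l_theta] from vanishing at points of Theta
   other than theta0 (local extrema or saddle points of the Kullback-Leibler
   divergence).  Near such a point the pivot equality has solutions for every
   large n, and these do not approach the maximum likelihood estimator.  K is a
   closed region free of such points: all of R^p when theta0 is the only root of
   E[l_theta] in Theta, and at least some closed ball around theta0 in general,
   since the root theta0 is isolated when A(theta0) is invertible. *)
Definition no_spurious_root (R : realType) (p : nat) (d : measure_display)
    (T : measurableType d) (nu : {measure set T -> \bar R}) (g : T -> R)
    (Theta : set 'cV[R]_p) (f : T -> 'cV[R]_p -> R) (theta0 : 'cV[R]_p)
    (K : set 'cV[R]_p) : Prop :=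
  closed K /\
  forall theta, Theta theta -> K theta -> score_pop nu g f theta = 0 ->
    theta = theta0.

(* Main.v *)
(* The law of large numbers holds uniformly over Theta for the log-likelihood,
   the score and its outer product, and uniformly near theta0 for the Hessian.
   Hence the maximum likelihood estimator that_n converges to theta0 and solves
   the score equation.  The pivot equality bounds the square of coordinate i of the
   mean score Z_n(PV_n) by (B_n)_ii c / n, so PV_n tends to a root of the expected
   score in K, which is theta0.  With u = PV_n - that_n the mean value theorem
   gives Z_n(PV_n) = - A1 u with A1 -> A(theta0), so both equalities have the
   shape n u^T M1 u = c and n t^2 u^T M2 u = c, where SW_n - that_n = t u and M1,
   M2 have the same positive definite limit A B^-1 A (A is symmetric by Schwarz's
   theorem).  Therefore sqrt n |u| is bounded and t -> 1.  No property of the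
   quantile c is used. *)

Require Import Defs.
From HB Require Import structures.
From mathcomp Require Import all_boot all_order all_algebra finmap.
From mathcomp Require Import all_classical all_reals all_analysis.
From mathcomp Require Import measurable_realfun zify ring lra.

Set Implicit Arguments.
Unset Strict Implicit.
Unset Printing Implicit Defensive.

Import Order.TTheory GRing.Theory Num.Theory.
Import numFieldNormedType.Exports.

Local Open Scope classical_set_scope.
Local Open Scope ring_scope.

(** * Strong law of large numbers *)

(** The estimators are arbitrary functions on the sample space, with no measurability assumed, so no
    law can be attached to them or to the intermediate points. The probabilistic input is therefore
    a set of laws uniform in the parameter, valid outside one null set; after that a sample path is
    fixed and the argument is deterministic. Two features of the conditions shape it further. The
    set [Theta] is only compact: a segment between two estimators may leave it, and the Hessian is
    shown measurable only at interior points, so the expansion and the law for the Hessian live in a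
    closed ball around [theta0]. And (A5) dominates the products of score components, not the score
    itself. The rate comes from the identity (t - 1)(t + 1) a2 = a1 - a2, where a1 and a2 are the
    values of the two quadratic forms at u: it makes t - 1 of the order of M1 - M2, so that for sqrt
    n |u| a mere bound suffices. *)

Lemma bounded_integrable d (T : measurableType d) (R : realType)
  (Q : probability T R) (xi : T -> R) (M : R) :
  measurable_fun setT xi -> (forall y, `|xi y| <= M) ->
  Q.-integrable setT (EFin \o xi).
Proof.
move=> mxi xiM; apply: measurable_bounded_integrable => //.
  by rewrite -ge0_fin_numE// fin_num_measure.
exists M; split; first by rewrite num_real.
by move=> x Mx y _; exact: le_trans (xiM y) (ltW Mx).
Qed.

Lemma integral_cst_probability d (T : measurableType d) (R : realType)
  (Q : probability T R) (r : R) : (\int[Q]_y r%:E = r%:E)%E.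
Proof.
by rewrite integral_cst// -[RHS]mule1; congr (_ * _)%E; exact: (probability_setT Q).
Qed.

Lemma borel_cantelli_ae d (Om : measurableType d) (R : realType)
    (P : probability Om R) (A : nat -> set Om) : (forall n, measurable (A n)) ->
  (\sum_(n <oo) P (A n) < +oo)%E ->
  {ae P, forall w, \forall n \near \oo, ~ A n w}.
Proof.
move=> mA sA; exists (lim_sup_set A); split.
- apply: bigcap_measurable => // k _.
  by apply: bigcup_measurable => j _; exact: mA.
- exact: lim_sup_set_cvg0.
- move=> w /= hw n _; apply: contra_notP hw => hw.
  exists n => // k /= nk Akw; apply: hw; exists k => //.
Qed.

(** Tonelli's theorem moves the sum under the integral. This is how each Borel-Cantelli hypothesis
    below is verified. *)
Lemma sum_integral_lty d (T : measurableType d) (R : realType)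
    (mu : {measure set T -> \bar R}) (u : nat -> T -> R) (h : T -> R) :
  (forall n, measurable_fun setT (u n)) -> (forall n y, 0 <= u n y) ->
  mu.-integrable setT (EFin \o h) ->
  (forall N y, \sum_(n < N) u n y <= h y) ->
  (\sum_(n <oo) \int[mu]_y (u n y)%:E < +oo)%E.
Proof.
move=> mu_ u0 ih uh.
rewrite -integral_nneseries//; last 2 first.
- by move=> n; exact/measurable_EFinP.
- by move=> n y _; rewrite lee_fin.
have h0 y : 0 <= h y by have := uh 0%N y; rewrite big_ord0.
apply: (@le_lt_trans _ _ (\int[mu]_y (h y)%:E)%E); last first.
  exact: integrable_lty ih.
apply: ge0_le_integral => //.
- by move=> y _; apply: nneseries_ge0 => n _ _; rewrite lee_fin.
- apply: ge0_emeasurable_sum => //.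
  + by move=> k y _ _; rewrite lee_fin.
  + by move=> k _; exact/measurable_EFinP.
- by move/integrableP : ih => [].
- move=> y _; apply: lime_le.
    by apply: is_cvg_nneseries => n _ _; rewrite lee_fin.
  by apply: nearW => N; rewrite big_mkord sumEFin lee_fin.
Qed.

Lemma dyadic_small_sum (R : realFieldType) (x : R) N : 0 <= x ->
  \sum_(n < N) x ^+ 2 / 2 ^+ n * (x <= 2 ^+ n)%R%:R <= 2 * x.
Proof.
move=> x0.
have p0 n : 0 < 2 ^+ n :> R by rewrite exprn_gt0.
(* The subtracted term is the geometric tail from index N on, which makes the bound inductive.
   Before the first power of 2 reaching x the sum is 0. *)
suff : \sum_(n < N) x ^+ 2 / 2 ^+ n * (x <= 2 ^+ n)%R%:R <=
    if x <= 2 ^+ N then 2 * x - 2 * (x ^+ 2 / 2 ^+ N) else 0.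
  move=> /le_trans; apply; case: ifPn => _; last by rewrite mulr_ge0.
  by rewrite gerBl mulr_ge0// divr_ge0// sqr_ge0.
elim: N => [|N ih].
  rewrite big_ord0 expr0 divr1; case: ifPn => // x1.
  by rewrite subr_ge0 ler_wpM2l// expr2 ler_piMl.
rewrite big_ord_recr/=.
have -> : x ^+ 2 / 2 ^+ N.+1 = x ^+ 2 / 2 ^+ N / 2.
  by rewrite (exprSr (2 : R)) invfM mulrA.
move: ih; have [xN ih|Nx ih] := leP x (2 ^+ N).
  have -> : x <= 2 ^+ N.+1.
    by rewrite (le_trans xN)// ler_eXn2l ?ler1n// ltr1n.
  rewrite mulr1; apply: le_trans (lerD ih (lexx _)) _.
  by rewrite le_eqVlt; apply/orP; left; apply/eqP; field.
rewrite mulr0 addr0 (le_trans ih)//; case: ifPn => // xN1.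
have {}xN1 : x / 2 ^+ N.+1 <= 1 by rewrite ler_pdivrMr// mul1r.
rewrite subr_ge0 ler_wpM2l//.
have -> : x ^+ 2 / 2 ^+ N / 2 = x * (x / 2 ^+ N.+1).
  by rewrite (exprSr (2 : R)) invfM; ring.
by rewrite ler_piMr.
Qed.

Lemma dyadic_large_sum (R : realFieldType) (x : R) N : 0 <= x ->
  \sum_(n < N) 2 ^+ n * (2 ^+ n < x)%R%:R <= 2 * x.
Proof.
move=> x0.
(* The bound 2^N - 1 drives the induction: if 2^N < x, adding 2^N to it stays below 2x. *)
suff : \sum_(n < N) 2 ^+ n * (2 ^+ n < x)%R%:R <= 2 ^+ N - 1 :> R /\
  \sum_(n < N) 2 ^+ n * (2 ^+ n < x)%R%:R <= 2 * x by case.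
elim: N => [|N [ih1 ih2]]; first by rewrite !big_ord0 expr0 subrr mulr_ge0.
rewrite !big_ord_recr/= exprS.
have p0 : 0 < 2 ^+ N :> R by rewrite exprn_gt0.
have [xN|xN] := ltP (2 ^+ N) x; last by rewrite mulr0 addr0; split; lra.
by rewrite mulr1; split; lra.
Qed.

Lemma measurable_fun_truth d (T : measurableType d) (R : realType)
    (b : T -> bool) : measurable_fun setT b ->
  measurable_fun setT (fun y => (b y)%:R : R).
Proof.
move=> mb; rewrite (_ : (fun y => _) = \1_(b @^-1` [set true])).
  by apply: measurable_indic; rewrite -[X in measurable X]setTI; exact: mb.
apply/funext => y; rewrite indicE; congr (_%:R); congr nat_of_bool.
by apply/idP/idP => [yb|/set_mem//]; exact: mem_set.
Qed.

(** * Chebyshev bounds and truncation for pairwise i.i.d. sequences *)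

Section pairwise_iid.
Context d d' (Om : measurableType d) (T : measurableType d') (R : realType)
  (P : probability Om R) (Y : nat -> {RV P >-> T}).

(** Independence is stated for pairs because the laws of large numbers below rest on the variance of
    a sum, which involves only pairs. *)
Definition pairwise_iid : Prop :=
  (forall n B, measurable B -> P (Y n @^-1` B) = P (Y 0%N @^-1` B)) /\
  (forall i j A B, i != j -> measurable A -> measurable B ->
    P (Y i @^-1` A `&` Y j @^-1` B) = (P (Y i @^-1` A) * P (Y j @^-1` B))%E).

Hypothesis iidY : pairwise_iid.

Let mu : probability T R := distribution P (Y 0%N).

Lemma ge0_integral_iid (n : nat) (phi : T -> \bar R) :
  measurable_fun setT phi -> (forall y, 0 <= phi y)%E ->
  (\int[P]_w phi (Y n w) = \int[mu]_y phi y)%E.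
Proof.
move=> mphi phi0.
rewrite -(ge0_integral_distribution (Y n))//.
by apply: eq_measure_integral => A mA _; exact: iidY.1.
Qed.

(** The joint law of [Y i] and [Y j] agrees with the product measure on rectangles, hence
    everywhere. Fubini's theorem then integrates out the second variable, where the mean 0
    appears. *)
Lemma iid_uncorrelated i j (xi : T -> R) (M : R) : i != j ->
  measurable_fun setT xi -> (forall y, `|xi y| <= M) ->
  (\int[mu]_y (xi y)%:E = 0)%E ->
  (\int[P]_w (xi (Y i w) * xi (Y j w))%:E = 0)%E.
Proof.
move=> ij mxi xiM xi0.
pose h w := (Y i w, Y j w).
have mh : measurable_fun setT h by apply: measurable_fun_pair.
pose xx (z : T * T) := xi z.1 * xi z.2.
have mxx : measurable_fun setT xx.
  by apply: measurable_funM; apply: measurableT_comp.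
have xxM z : `|xx z| <= M * M by rewrite normrM ler_pM.
have xxint (d1 : measure_display) (T1 : measurableType d1) (Q : probability T1 R)
    (k : T1 -> T * T) : measurable_fun setT k ->
    Q.-integrable setT (EFin \o (xx \o k)).
  move=> mk; apply: (@bounded_integrable _ _ _ _ _ (M * M)) => //.
    exact: measurableT_comp.
  by move=> y; exact: xxM.
transitivity (\int[pushforward P h]_z (xx z)%:E)%E.
  rewrite (integral_pushforward mh)//=.
    exact/measurable_EFinP.
  exact: xxint.
transitivity (\int[(mu \x mu)%E]_z (xx z)%:E)%E.
  apply: eq_measure_integral => A mA _; apply/esym.
  apply: (product_measure_unique (m' := pushforward P h)) => // B C mB mC.
  transitivity (P (Y i @^-1` B `&` Y j @^-1` C)); first by [].
  by rewrite iidY.2// iidY.1// (iidY.1 _ _ mC).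
rewrite -integral12_prod_meas1.
- rewrite /fubini_F/= /xx/=.
  under eq_integral.
    move=> x _.
    under eq_integral do rewrite EFinM.
    rewrite integralZl//; last exact: (@bounded_integrable _ _ _ _ _ M).
    rewrite xi0 mule0.
    over.
  by rewrite integral0.
- have mxxE : measurable_fun setT (EFin \o xx) by exact/measurable_EFinP.
  have := xxint _ _ (mu \x mu)%E id (@measurable_id _ _ _).
  exact.
Qed.

(** The second moment stands on the right instead of the variance because it is the integral of an
    explicit function: the bounds for different n can be summed under the integral sign. *)
Lemma iid_chebyshev (n : nat) (psi : T -> R) (M a : R) : 0 < a ->
  measurable_fun setT psi -> (forall y, `|psi y| <= M) ->
  (P [set w | (a <= `|\sum_(i < n) psi (Y i w)
                     - n%:R * \int[mu]_y psi y|)%R]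
    <= (n%:R / a ^+ 2)%:E * \int[mu]_y ((psi y) ^+ 2)%:E)%E.
Proof.
move=> a0 mpsi psiM; set m := (\int[mu]_y psi y)%R.
have M0 : 0 <= M by exact: le_trans (normr_ge0 _) (psiM point).
have mmu (phi : T -> R) (N : R) : measurable_fun setT phi ->
    (forall y, `|phi y| <= N) -> mu.-integrable setT (EFin \o phi).
  exact: bounded_integrable.
have mP (phi : Om -> R) (N : R) : measurable_fun setT phi ->
    (forall y, `|phi y| <= N) -> P.-integrable setT (EFin \o phi).
  exact: bounded_integrable.
pose xi y := psi y - m.
have mxi : measurable_fun setT xi by exact: measurable_funB.
have xiM y : `|xi y| <= M + `|m|.
  by rewrite (le_trans (ler_normB _ _))// lerD2r.
have xi0 : (\int[mu]_y (xi y)%:E = 0)%E.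
  have ipsi := mmu _ _ mpsi psiM.
  have im : mu.-integrable setT (EFin \o cst m).
    by apply: (mmu _ `|m|) => //; exact: measurable_cst.
  rewrite /xi integralB_EFin//= (integral_cst_probability mu).
  by rewrite /m /Rintegral fineK ?subee// integrable_fin_num.
(* Expand psi^2 = xi^2 + 2 m xi + m^2: the middle term integrates to 0 and the last one is
   nonnegative. *)
have xi2le : (\int[mu]_y ((xi y) ^+ 2)%:E <= \int[mu]_y ((psi y) ^+ 2)%:E)%E.
  have mpsi2 : measurable_fun setT (fun y => psi y ^+ 2) by exact: measurable_funX.
  have ipsi2 : mu.-integrable setT (EFin \o (fun y => psi y ^+ 2)).
    by apply: (mmu _ (M ^+ 2)) => // y; rewrite normrX lerXn2r// nnegrE.
  have ixi : mu.-integrable setT (EFin \o (fun y => 2 * m * xi y)).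
    apply: (mmu _ (`|2 * m| * (M + `|m|))); first exact: measurable_funM.
    by move=> y; rewrite normrM ler_wpM2l.
  have im : mu.-integrable setT (EFin \o cst (m ^+ 2)).
    by apply: (mmu _ `|m ^+ 2|) => //; exact: measurable_cst.
  have -> : (fun y => ((psi y) ^+ 2)%:E) =
      (fun y => ((xi y ^+ 2)%:E + (2 * m * xi y + m ^+ 2)%:E))%E.
    by apply/funext => y; rewrite -EFinD; congr EFin; rewrite /xi; ring.
  rewrite integralD//.
  - rewrite leeDl// integralD_EFin//= (integral_cst_probability mu).
    under eq_integral do rewrite EFinM.
    rewrite integralZl//; last exact: mmu xiM.
    by rewrite xi0 mule0 add0e lee_fin sqr_ge0.
  - have := @mmu (fun y => xi y ^+ 2) ((M + `|m|) ^+ 2).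
    apply; first exact: measurable_funX.
    by move=> y; rewrite normrX lerXn2r ?nnegrE// addr_ge0.
  - exact: (integrableD measurableT ixi im).
pose S w := \sum_(i < n) xi (Y i w).
have SE w : \sum_(i < n) psi (Y i w) - n%:R * m = S w.
  rewrite /S /xi sumrB; congr (_ - _).
  by rewrite sumr_const card_ord mulr_natl.
have mS : measurable_fun setT S.
  by apply: measurable_sum => i; exact: measurableT_comp.
(* Only the n diagonal terms of the double sum survive. *)
have ES : (\int[P]_w ((S w) ^+ 2)%:E = n%:R%:E * \int[mu]_y ((xi y) ^+ 2)%:E)%E.
  have ixx (i j : 'I_n) : P.-integrable setT
      (fun w => (xi (Y i w) * xi (Y j w))%:E).
    have := @mP (fun w => xi (Y i w) * xi (Y j w)) ((M + `|m|) * (M + `|m|)).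
    apply; first by apply: measurable_funM; exact: measurableT_comp.
    by move=> w; rewrite normrM ler_pM.
  transitivity (\int[P]_w (\sum_(i < n) \sum_(j < n)
      (xi (Y i w) * xi (Y j w))%:E))%E.
    apply: eq_integral => w _; rewrite expr2 /S mulr_suml -sumEFin.
    by apply: eq_bigr => i _; rewrite mulr_sumr sumEFin.
  rewrite integral_sum//; last by move=> i; exact: integrable_sum.
  transitivity (\sum_(i < n) \int[mu]_y ((xi y) ^+ 2)%:E)%E.
    apply: eq_bigr => i _; rewrite integral_sum// (bigD1 i)//= big1.
      rewrite adde0 -(ge0_integral_iid i)//.
      - by apply/measurable_EFinP; exact: measurable_funX.
      - by move=> y; rewrite lee_fin sqr_ge0.
    move=> j ji; apply: iid_uncorrelated mxi xiM xi0.
    by rewrite eq_sym.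
  rewrite mule_natl big_const card_ord; elim: {+}n => [|k ih]; first by rewrite mule0n.
  by rewrite iterS ih muleS.
have mA : measurable [set w | a <= `|S w|].
  have := measurable_fun_ler (measurable_cst a)
    (measurableT_comp (@normr_measurable R setT) mS).
  by move=> /(_ measurableT [set true] I); rewrite setTI.
rewrite (_ : [set w | _] = [set w | a <= `|S w|]); last first.
  by apply/seteqP; split => w /=; rewrite SE.
apply: le_trans (lee_wpmul2l _ xi2le); last first.
  by rewrite lee_fin divr_ge0// sqr_ge0.
have a2 : 0 < a ^+ 2 by rewrite exprn_gt0.
rewrite mulrC EFinM -muleA -ES -[leLHS]mul1e.
rewrite -[in leLHS](mulVf (lt0r_neq0 a2)) EFinM -muleA lee_wpmul2l//.
  by rewrite lee_fin invr_ge0 ltW.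
rewrite -integral_cst//.
apply: (@le_trans _ _ (\int[P]_(w in [set w | (a <= `|S w|)%R]) ((S w) ^+ 2)%:E)%E).
  apply: ge0_le_integral => //.
  - by move=> w _; rewrite lee_fin ltW.
  - by apply/measurable_EFinP/measurable_funTS; exact: measurable_funX.
  - move=> w /= aS; rewrite lee_fin -(real_normK (num_real (S w))).
    by rewrite lerXn2r// nnegrE ltW.
apply: ge0_subset_integral => //.
- by apply/measurable_EFinP; exact: measurable_funX.
- by move=> w _; rewrite lee_fin sqr_ge0.
Qed.

(* Truncating at level 2^n on the dyadic block of length 2^n makes both the
   Chebyshev bounds and the truncation errors summable; passing from dyadic to
   arbitrary n costs the factor 2, which is harmless when phi is the small tail
   in iid_slln_eps. *)
Lemma iid_upper_bound (phi : T -> R) (b : R) :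
  (forall y, 0 <= phi y) -> mu.-integrable setT (EFin \o phi) ->
  \int[mu]_y phi y < b ->
  {ae P, forall w, \forall n \near \oo,
     \sum_(i < n) phi (Y i w) <= n%:R * (2 * b)}.
Proof.
move=> phi0 iphi phib.
have mphi : measurable_fun setT phi.
  by move/integrableP : iphi => [/measurable_EFinP].
have i2phi : mu.-integrable setT (EFin \o (fun y => 2 * phi y)).
  exact: (integrableZl measurableT 2 iphi).
set m := \int[mu]_y phi y in phib *.
pose e := b - m.
have e0 : 0 < e by rewrite subr_gt0.
have p0 n : 0 < 2 ^+ n :> R by rewrite exprn_gt0.
pose small n y : R := (phi y <= 2 ^+ n)%R%:R.
pose large n y : R := (2 ^+ n < phi y)%R%:R.
have msmall n : measurable_fun setT (small n).
  by apply: measurable_fun_truth; apply: measurable_fun_ler.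
have mlarge n : measurable_fun setT (large n).
  by apply: measurable_fun_truth; apply: measurable_fun_ltr.
pose psi n y := phi y * small n y.
have mpsi n : measurable_fun setT (psi n) by exact: measurable_funM.
have psi0 n y : 0 <= psi n y by rewrite mulr_ge0.
have psiM n y : `|psi n y| <= 2 ^+ n.
  rewrite ger0_norm// /psi /small; case: (leP (phi y)) => h; first by rewrite mulr1.
  by rewrite mulr0 ltW.
have psi_phi n y : psi n y <= phi y.
  by rewrite /psi /small; case: (leP (phi y)) => h; rewrite ?mulr1 ?mulr0.
have psim n : \int[mu]_y psi n y <= m.
  apply: le_Rintegral => //; exact: bounded_integrable (psiM n).
(* [A n]: the truncated sum over the first 2^n observations is off by at least 2^n e. [B n]: one of
   these observations exceeds the truncation level. Outside both, the full sum is at most 2^n (m +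
   e) = 2^n b. *)
pose A n := [set w | 2 ^+ n * e <=
  `|\sum_(i < 2 ^ n) psi n (Y i w) - (2 ^ n)%:R * \int[mu]_y psi n y|].
pose B n := \bigcup_(i < (2 ^ n)%N) [set w | 2 ^+ n < phi (Y i w)].
have mA n : measurable (A n).
  have mS : measurable_fun setT (fun w =>
      `|\sum_(i < 2 ^ n) psi n (Y i w) - (2 ^ n)%:R * \int[mu]_y psi n y|).
    apply: measurableT_comp => //; apply: measurable_funB => //.
    by apply: measurable_sum => i; exact: measurableT_comp.
  have := measurable_fun_ler (measurable_cst (2 ^+ n * e : R)) mS.
  by move=> /(_ measurableT [set true] I); rewrite setTI.
have mBi n i : measurable [set w | 2 ^+ n < phi (Y i w)].
  have := measurable_fun_ltr (measurable_cst (2 ^+ n : R))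
    (measurableT_comp mphi (measurable_funPT (Y i))).
  by move=> /(_ measurableT [set true] I); rewrite setTI.
have mB n : measurable (B n) by apply: bigcup_measurable.
(* At the threshold 2^n e Chebyshev gives e^-2 times the mean of phi^2 1(phi <= 2^n) / 2^n; by
   [dyadic_small_sum] these sum to at most 2 e^-2 times the mean of phi. *)
have sumA : (\sum_(n <oo) P (A n) < +oo)%E.
  apply: (@le_lt_trans _ _ (\sum_(n <oo) \int[mu]_y
      ((e ^- 2) * (phi y ^+ 2 / 2 ^+ n * small n y))%:E)%E).
    apply: lee_nneseries => // n _.
    have := iid_chebyshev (2 ^ n)%N (mulr_gt0 (p0 n) e0) (mpsi n) (psiM n).
    move=> /le_trans; apply.
    rewrite -ge0_integralZl_EFin//; last 3 first.
    - by move=> y _; rewrite lee_fin sqr_ge0.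
    - by apply/measurable_EFinP; exact: measurable_funX.
    - by rewrite divr_ge0// sqr_ge0.
    apply: ge0_le_integral => //.
    - by move=> y _; rewrite lee_fin !mulr_ge0// ?invr_ge0 ?sqr_ge0.
    - apply/measurable_EFinP; apply: measurable_funM => //.
      exact: measurable_funX.
    - apply/measurable_EFinP; apply: measurable_funM => //.
      apply: measurable_funM => //.
      by apply: measurable_funM => //; exact: measurable_funX.
    - move=> y _; rewrite -EFinM lee_fin le_eqVlt; apply/orP; left; apply/eqP.
      have ss : small n y ^+ 2 = small n y.
        by rewrite /small; case: (_ <= _)%R; rewrite ?expr1n// expr0n.
      rewrite /psi (exprMn _ (phi y)) ss natrX; field.
      by rewrite lt0r_neq0//= lt0r_neq0// expf_neq0.
  apply: (@sum_integral_lty _ _ _ mu _ (fun y => e ^- 2 * (2 * phi y))).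
  - move=> n; apply: measurable_funM => //.
    apply: measurable_funM => //.
    by apply: measurable_funM => //; exact: measurable_funX.
  - by move=> n y; rewrite !mulr_ge0// ?invr_ge0 ?sqr_ge0// ltW.
  - exact: (integrableZl measurableT (e ^- 2) i2phi).
  - move=> N y; rewrite -mulr_sumr ler_wpM2l ?invr_ge0 ?sqr_ge0//.
    exact: dyadic_small_sum.
(* The union bound gives 2^n times the probability of phi > 2^n, and [dyadic_large_sum] bounds the
   total by twice the mean of phi. *)
have sumB : (\sum_(n <oo) P (B n) < +oo)%E.
  apply: (@le_lt_trans _ _ (\sum_(n <oo) \int[mu]_y
      (2 ^+ n * large n y)%:E)%E).
    apply: lee_nneseries => // n _.
    have multy : measurable [set y | 2 ^+ n < phi y].
      have := measurable_fun_ltr (measurable_cst (2 ^+ n : R)) mphi.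
      by move=> /(_ measurableT [set true] I); rewrite setTI.
    apply: (@le_trans _ _ (\sum_(i < 2 ^ n) P [set w | (2 ^+ n < phi (Y i w))%R])%E).
      rewrite /B bigcup_mkord; apply: (Boole_inequality P
        (A := fun i => [set w | (2 ^+ n < phi (Y i w))%R])) => i _.
      exact: mBi.
    have hP i : P [set w | (2 ^+ n < phi (Y i w))%R] = (\int[mu]_y (large n y)%:E)%E.
      rewrite -(ge0_integral_iid i)//; last 2 first.
      - exact/measurable_EFinP.
      - by move=> y; rewrite lee_fin.
      rewrite -[X in P X]setIT -integral_indic//; apply: eq_integral => w _.
      rewrite indicE /large; congr (_%:R%:E); congr nat_of_bool.
      case: (ltP (2 ^+ n) (phi (Y i w))) => h; first exact/mem_set.
      by apply/memNset/negP; rewrite -leNgt.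
    rewrite (eq_bigr (fun=> \int[mu]_y (large n y)%:E)%E)//.
    rewrite big_const card_ord.
    under [leRHS]eq_integral do rewrite EFinM.
    rewrite ge0_integralZl_EFin//; last 2 first.
    - by move=> y _; rewrite lee_fin.
    - exact/measurable_EFinP.
    rewrite -natrX mule_natl.
    elim: (2 ^ n)%N => [|k ih]; first by rewrite mule0n.
    by rewrite iterS muleS leeD2l.
  apply: (@sum_integral_lty _ _ _ mu _ (fun y => 2 * phi y)) => //.
  - by move=> n; apply: measurable_funM.
  - by move=> n y; rewrite mulr_ge0// ltW.
  - by move=> N y; exact: dyadic_large_sum.
have hA := borel_cantelli_ae mA sumA.
have hB := borel_cantelli_ae mB sumB.
apply: filterS2 hA hB => w [NA _ hA] [NB _ hB].
exists (2 ^ (maxn NA NB)).+1 => // k /= Nk.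
have k0 : (0 < k)%N by exact: leq_ltn_trans Nk.
have /andP[lk kl] := trunc_log_bounds (isT : 1 < 2)%N k0.
(* This is the least n with k < 2^n, so that 2^n <= 2k; enlarging the sum from k to 2^n terms is
   allowed because phi is nonnegative. *)
set n := (trunc_log 2 k).+1 in kl.
have Nn : (maxn NA NB <= n)%N.
  by rewrite ltnW// -(ltn_exp2l _ _ (isT : 1 < 2)%N) (ltn_trans Nk).
have nA : (NA <= n)%N by rewrite (leq_trans _ Nn)// leq_maxl.
have nB : (NB <= n)%N by rewrite (leq_trans _ Nn)// leq_maxr.
apply: (@le_trans _ _ (2 ^+ n * b)); last first.
  have b0 : 0 <= b by rewrite ltW// (le_lt_trans _ phib)// Rintegral_ge0.
  rewrite mulrA ler_wpM2r// -natrX -natrM ler_nat /n expnS mulnC.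
  by rewrite leq_mul2r lk orbT.
apply: (@le_trans _ _ (\sum_(i < 2 ^ n) phi (Y i w))).
  rewrite -!(big_mkord xpredT (fun i => phi (Y i w))).
  rewrite [leRHS](big_cat_nat (n := k))//=; last exact: ltnW.
  by rewrite lerDl; apply: sumr_ge0 => i _; exact: phi0.
have -> : \sum_(i < 2 ^ n) phi (Y i w) = \sum_(i < 2 ^ n) psi n (Y i w).
  apply: eq_bigr => i _; rewrite /psi /small.
  have [h|h] := leP (phi (Y i w)); first by rewrite mulr1.
  by exfalso; apply: (hB n nB); exists (i : nat); [exact: ltn_ord|exact: h].
have /negP := hA n nA; rewrite -ltNge => /(le_lt_trans (ler_norm _)).
rewrite ltrBlDl => /ltW /le_trans; apply.
rewrite natrX -mulrDr ler_wpM2l ?(ltW (p0 _))//.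
by rewrite /e; have := psim n; lra.
Qed.

End pairwise_iid.

Lemma sum_inv_sqr (R : realFieldType) N :
  \sum_(k < N) (k.+1%:R ^+ 2)^-1 <= 2 :> R.
Proof.
have p0 n : 0 < n.+1%:R :> R by rewrite ltr0n.
(* Telescoping: 1 / (M+2)^2 is below 1 / (M+1) - 1 / (M+2). *)
suff H M : \sum_(k < M.+1) (k.+1%:R ^+ 2)^-1 <= 2 - M.+1%:R^-1 :> R.
  case: N => [|N]; first by rewrite big_ord0.
  by rewrite (le_trans (H N))// gerBl invr_ge0 ltW.
elim: M => [|M ih]; first by rewrite big_ord1 expr1n !invr1; lra.
rewrite big_ord_recr/= (le_trans (lerD ih (lexx _)))//.
have h1 := p0 M; have h2 := p0 M.+1.
have E2 : M.+2%:R = M.+1%:R + 1 :> R by rewrite natr1.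
rewrite -subr_ge0.
have -> : 2 - M.+2%:R^-1 - (2 - M.+1%:R^-1 + (M.+2%:R ^+ 2)^-1)
    = (M.+1%:R * M.+2%:R ^+ 2)^-1 :> R.
  by rewrite E2 in h2 *; field; rewrite !gt_eqF.
by rewrite invr_ge0 mulr_ge0 ?sqr_ge0// ltW.
Qed.

Lemma exists_sqrtn n : exists k, (k ^ 2 <= n < k.+1 ^ 2)%N.
Proof.
elim: n => [|n [k /andP[kn nk]]]; first by exists 0%N.
have [h|h] := ltnP n.+1 (k.+1 ^ 2); first by exists k; rewrite h ltnW// ltnS.
exists k.+1; rewrite h (leq_ltn_trans nk)//.
by rewrite ltn_exp2r.
Qed.

(** * The strong law, from bounded to integrable functions *)

Section slln.
Context d d' (Om : measurableType d) (T : measurableType d') (R : realType)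
  (P : probability Om R) (Y : nat -> {RV P >-> T}).
Hypothesis iidY : pairwise_iid Y.
Let mu : probability T R := distribution P (Y 0%N).

(* Chebyshev along the squares k^2, then interpolation: consecutive squares are
   only 2k + 1 apart. *)
Lemma iid_bounded_slln (psi : T -> R) (M : R) (e : R) : 0 < e ->
  measurable_fun setT psi -> (forall y, `|psi y| <= M) ->
  {ae P, forall w, \forall n \near \oo,
     `|\sum_(i < n) psi (Y i w) - n%:R * \int[mu]_y psi y| <= n%:R * e}.
Proof.
move=> e0 mpsi psiM; set m := \int[mu]_y psi y.
have M0 : 0 <= M by exact: le_trans (normr_ge0 _) (psiM point).
have ipsi : mu.-integrable setT (EFin \o psi) by exact: bounded_integrable psiM.
have iM : mu.-integrable setT (EFin \o cst M).
  by apply: (bounded_integrable _ (M := `|M|)) => //; exact: measurable_cst.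
have ipsi2 : mu.-integrable setT (EFin \o (fun y => psi y ^+ 2)).
  apply: (bounded_integrable _ (M := M ^+ 2)); first exact: measurable_funX.
  by move=> y; rewrite normrX lerXn2r// nnegrE.
have mM : `|m| <= M.
  apply: le_trans (le_normr_Rintegral measurableT ipsi) _.
  have -> : M = \int[mu]_y cst M y.
    by rewrite /Rintegral/= (integral_cst_probability mu).
  apply: le_Rintegral => //; exact: integrable_norm.
(* One half of e pays for the deviation at the squares, the other for the interpolation between
   them. *)
pose e' := e / 2.
have e'0 : 0 < e' by rewrite divr_gt0.
pose S k w := \sum_(i < k) psi (Y i w) - k%:R * m.
have mS k : measurable_fun setT (S k).
  apply: measurable_funB => //.
  by apply: measurable_sum => i; exact: measurableT_comp.
pose A k := [set w | k.+1%:R ^+ 2 * e' <= `|S (k.+1 ^ 2)%N w|].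
have mA k : measurable (A k).
  have := measurable_fun_ler (measurable_cst (k.+1%:R ^+ 2 * e' : R))
    (measurableT_comp (@normr_measurable R setT) (mS (k.+1 ^ 2)%N)).
  by move=> /(_ measurableT [set true] I); rewrite setTI.
have sumA : (\sum_(k <oo) P (A k) < +oo)%E.
  apply: (@le_lt_trans _ _ (\sum_(k <oo) \int[mu]_y
      ((e' ^- 2 * psi y ^+ 2) * (k.+1%:R ^+ 2)^-1)%:E)%E).
    apply: lee_nneseries => // k _.
    have k0 : 0 < k.+1%:R ^+ 2 * e' :> R by rewrite mulr_gt0// exprn_gt0.
    have := iid_chebyshev iidY (k.+1 ^ 2)%N k0 mpsi psiM.
    move=> /le_trans; apply.
    rewrite -ge0_integralZl_EFin//; last 3 first.
    - by move=> y _; rewrite lee_fin sqr_ge0.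
    - by apply/measurable_EFinP; exact: measurable_funX.
    - by rewrite divr_ge0// sqr_ge0.
    apply: ge0_le_integral => //.
    - by move=> y _; apply: mule_ge0; rewrite lee_fin ?divr_ge0 ?sqr_ge0.
    - apply/measurable_EFinP; apply: measurable_funM => //.
      exact: measurable_funX.
    - apply/measurable_EFinP; apply: measurable_funM => //.
      by apply: measurable_funM => //; exact: measurable_funX.
    - move=> y _; rewrite -EFinM lee_fin le_eqVlt; apply/orP; left; apply/eqP.
      rewrite natrX; field.
      by rewrite nat1r pnatr_eq0/= gt_eqF.
  apply: (@sum_integral_lty _ _ _ mu _ (fun y => e' ^- 2 * psi y ^+ 2 * 2)).
  - move=> k; apply: measurable_funM => //.
    by apply: measurable_funM => //; exact: measurable_funX.
  - by move=> k y; apply: mulr_ge0; [apply: mulr_ge0|]; rewrite ?invr_ge0 sqr_ge0.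
  - apply: eq_integrable (integrableZl measurableT (e' ^- 2 * 2) ipsi2) => //.
    by move=> y _ /=; rewrite -EFinM mulrAC.
  - move=> N y; rewrite -mulr_sumr ler_wpM2l ?sum_inv_sqr//.
    by apply: mulr_ge0; rewrite ?invr_ge0 sqr_ge0.
have := borel_cantelli_ae mA sumA.
apply: filterS => w [N _ hN].
(* Between k^2 and n there are at most 2k terms, each at most 2M in absolute value. The second
   argument of the maximum makes 4M <= k e', so they contribute at most k^2 e'; the first gives k >
   N, which puts the index k - 1 of the event within reach of Borel-Cantelli. *)
pose K := maxn N.+1 (Num.truncn (4 * M / e')).+1.
exists (K.+1 ^ 2)%N => // n /= Kn.
have [k /andP[kn nk]] := exists_sqrtn n.
have Kk : (K < k.+1)%N.
  by rewrite -(@ltn_exp2r _ _ 2)// (leq_ltn_trans _ nk)// (leq_trans _ Kn)// leq_exp2r.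
have [k' kE] : exists k', k = k'.+1.
  by exists k.-1; rewrite prednK// (leq_trans _ (Kk : K <= k)%N)// leq_max.
have Nk' : (N <= k')%N.
  by rewrite -ltnS -kE (leq_trans _ (Kk : K <= k)%N)// leq_maxl.
have Mk : 4 * M <= k%:R * e'.
  rewrite -ler_pdivrMr//; apply: ltW (lt_le_trans (truncnS_gt _) _).
  by rewrite ler_nat (leq_trans _ (Kk : K <= k)%N)// leq_maxr.
have h1 : `|S (k ^ 2)%N w| <= k%:R ^+ 2 * e'.
  by have /negP := hN k' Nk'; rewrite -ltNge -kE => /ltW.
have SE : S n w = S (k ^ 2)%N w + \sum_(k ^ 2 <= i < n) (psi (Y i w) - m).
  rewrite /S -!(big_mkord xpredT (fun i => psi (Y i w))).
  rewrite (big_cat_nat (leq0n _) kn)//= sumrB sumr_const_nat.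
  have nE : n%:R = (k ^ 2)%:R + (n - k ^ 2)%:R :> R by rewrite -natrD subnKC.
  by rewrite nE -(mulr_natl m); ring.
rewrite -/(S n w) SE (le_trans (ler_normD _ _))//.
have h2 : `|\sum_(k ^ 2 <= i < n) (psi (Y i w) - m)| <= k%:R * (4 * M).
  apply: le_trans (ler_norm_sum _ _ _) _.
  apply: (@le_trans _ _ (\sum_(k ^ 2 <= i < n) (M + M))).
    by apply: ler_sum => i _; rewrite (le_trans (ler_normB _ _))// lerD.
  rewrite sumr_const_nat -(mulr_natl (M + M)).
  have : (n - k ^ 2 <= 2 * k)%N.
    rewrite leq_subLR; move: nk; rewrite !expnS !expn0 => nk.
    by lia.
  rewrite -(ler_nat R) natrM => nk2.
  apply: le_trans (ler_wpM2r (addr_ge0 M0 M0) nk2) _.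
  by rewrite le_eqVlt; apply/orP; left; apply/eqP; ring.
apply: (@le_trans _ _ (k%:R ^+ 2 * e)).
  apply: le_trans (lerD h1 h2) _.
  apply: le_trans (lerD (lexx _) (ler_wpM2l _ Mk)) _; first by [].
  by rewrite le_eqVlt; apply/orP; left; apply/eqP; rewrite /e'; field.
by rewrite ler_wpM2r ?(ltW e0)// -natrX ler_nat.
Qed.

(** Truncate at a fixed level k for which the remainder has mean below t = e/4. The bounded part
    costs t, the shift of the mean another t, and the remainder 2t through the one-sided bound
    [iid_upper_bound], whose factor 2 is absorbed in the choice of t. *)
Lemma iid_slln_eps (phi : T -> R) (e : R) : 0 < e ->
  mu.-integrable setT (EFin \o phi) ->
  {ae P, forall w, \forall n \near \oo,
     `|\sum_(i < n) phi (Y i w) - n%:R * \int[mu]_y phi y| <= n%:R * e}.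
Proof.
move=> e0 iphi.
have mphi : measurable_fun setT phi.
  by move/integrableP : iphi => [/measurable_EFinP].
have iaphi : mu.-integrable setT (EFin \o (fun y => `|phi y|)).
  exact: integrable_norm.
have maphi : measurable_fun setT (fun y => `|phi y|) by exact: measurableT_comp.
pose large k y : R := (k%:R < `|phi y|)%R%:R.
pose small k y : R := (`|phi y| <= k%:R)%R%:R.
have mlarge k : measurable_fun setT (large k).
  by apply: measurable_fun_truth; apply: measurable_fun_ltr.
have msmall k : measurable_fun setT (small k).
  by apply: measurable_fun_truth; apply: measurable_fun_ler.
pose rest k y := `|phi y| * large k y.
have mrest k : measurable_fun setT (rest k) by exact: measurable_funM.
have rest0 k y : 0 <= rest k y by rewrite mulr_ge0.
have rest_phi k y : rest k y <= `|phi y|.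
  by rewrite /rest ler_piMr// /large; case: (_ < _)%R.
have irest k : mu.-integrable setT (EFin \o rest k).
  apply: le_integrable iaphi => //; first exact/measurable_EFinP.
  by move=> y _ /=; rewrite !lee_fin normr_id ger0_norm.
have rest_cvg : (\int[mu]_y (rest k y)%:E)%E @[k --> \oo] --> (\int[mu]_y (0 : \bar R))%E.
  have [] := @dominated_convergence _ T R mu setT measurableT
    (fun k y => (rest k y)%:E) (cst 0%E) (fun y => `|phi y|%:E) _ _ _ iaphi _.
  - by move=> k; exact/measurable_EFinP.
  - exact: measurable_cst.
  - apply: aeW => y _; apply: cvg_near_cst.
    exists (Num.truncn `|phi y|).+1 => // k /= hk.
    rewrite /rest /large ltNge (ltW (lt_le_trans (truncnS_gt _) _)) ?ler_nat//.
    by rewrite mulr0.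
  - apply: aeW => y k _; rewrite lee_fin ger0_norm//; exact: rest_phi.
  - by [].
rewrite integral0 in rest_cvg.
pose t := e / 4.
have t0 : 0 < t by rewrite divr_gt0.
have [k hk] : exists k, \int[mu]_y rest k y < t.
  have /fine_cvgP[_ /cvgrPdist_lt /(_ t t0)[k _ /(_ k (leqnn k))]] := rest_cvg.
  rewrite sub0r normrN => /(le_lt_trans (ler_norm _)) h.
  by exists k.
pose psi y := phi y * small k y.
have mpsi : measurable_fun setT psi by exact: measurable_funM.
have psiM y : `|psi y| <= k%:R.
  rewrite /psi /small normrM; case: (leP `|phi y|) => h.
    by rewrite normr1 mulr1.
  by rewrite normr0 mulr0.
have ipsi : mu.-integrable setT (EFin \o psi) by exact: bounded_integrable psiM.
have phi_psi y : `|phi y - psi y| = rest k y.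
  rewrite /psi /rest /small /large; case: (leP `|phi y|) => h.
    by rewrite !mulr1 mulr0 subrr normr0.
  by rewrite mulr0 subr0 mulr1.
have dm : `|\int[mu]_y phi y - \int[mu]_y psi y| <= t.
  rewrite -RintegralB//; apply: le_trans (ltW hk).
  have ipp : mu.-integrable setT (EFin \o (fun y => phi y - psi y)).
    exact: (integrableB measurableT iphi ipsi).
  apply: le_trans (le_normr_Rintegral measurableT ipp) _.
  by under eq_Rintegral do rewrite phi_psi.
have := iid_upper_bound iidY (rest0 k) (irest k) hk.
have := iid_bounded_slln t0 mpsi psiM.
apply: filterS2 => w [N1 _ h1] [N2 _ h2].
exists (maxn N1 N2) => // n /=; rewrite geq_max => /andP[n1 n2].
have {}h1 := h1 n n1; have {}h2 := h2 n n2.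
have h3 : `|\sum_(i < n) phi (Y i w) - \sum_(i < n) psi (Y i w)| <=
    \sum_(i < n) rest k (Y i w).
  rewrite -sumrB (le_trans (ler_norm_sum _ _ _))//.
  by apply: ler_sum => i _; rewrite phi_psi.
have h4 : `|n%:R * \int[mu]_y psi y - n%:R * \int[mu]_y phi y| <= n%:R * t.
  by rewrite -mulrBr normrM ger0_norm// ler_wpM2l// distrC.
rewrite (_ : _ - _ = (\sum_(i < n) phi (Y i w) - \sum_(i < n) psi (Y i w)) +
  (\sum_(i < n) psi (Y i w) - n%:R * \int[mu]_y psi y) +
  (n%:R * \int[mu]_y psi y - n%:R * \int[mu]_y phi y)); last by ring.
apply: le_trans (ler_normD _ _) _.
apply: le_trans (lerD (ler_normD _ _) h4) _.
apply: le_trans (lerD (lerD (le_trans h3 h2) h1) (lexx _)) _.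
by rewrite le_eqVlt; apply/orP; left; apply/eqP; rewrite /t; field.
Qed.

Lemma iid_slln (phi : T -> R) : mu.-integrable setT (EFin \o phi) ->
  {ae P, forall w, n%:R^-1 * (\sum_(i < n) phi (Y i w)) @[n --> \oo]
     --> \int[mu]_y phi y}.
Proof.
move=> iphi.
have : {ae P, forall w, forall k : nat, \forall n \near \oo,
   `|\sum_(i < n) phi (Y i w) - n%:R * \int[mu]_y phi y| <= n%:R * k.+1%:R^-1}.
  by apply: ae_foralln => k; apply: iid_slln_eps => //; rewrite invr_gt0.
apply: filterS => w hw; apply/cvgrPdist_le => e e0.
have [k] := ltr_add_invr e0; rewrite add0r => ke.
near=> n.
have n0 : 0 < n%:R :> R by rewrite ltr0n; near: n; exists 1%N.
have : `|\sum_(i < n) phi (Y i w) - n%:R * \int[mu]_y phi y| <= n%:R * k.+1%:R^-1.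
  by near: n; exact: hw.
rewrite -ler_pdivrMl// -[X in X * _]gtr0_norm ?invr_gt0// -normrM.
rewrite mulrBr mulrA mulVf ?gt_eqF// mul1r distrC => /le_trans; apply.
exact: ltW.
Unshelve. all: by end_near. Qed.

End slln.

(** * Uniform law of large numbers *)

Section density.
Context d (T : measurableType d) (R : realType)
  (nu : {measure set T -> \bar R}) (g : T -> R) (mu : {measure set T -> \bar R}).
Hypotheses (mg : measurable_fun setT g) (g0 : forall y, 0 <= g y)
  (muE : forall B, measurable B -> mu B = (\int[nu]_(y in B) (g y)%:E)%E).

Import HBNNSimple.

Lemma nnsfun_integral_density (h : {nnsfun T >-> R}) :
  (\int[mu]_y (h y)%:E = \int[nu]_y ((h y)%:E * (g y)%:E))%E.
Proof.
have mgE : measurable_fun setT (EFin \o g) by exact/measurable_EFinP.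
transitivity (\sum_(k \in range h) \int[mu]_y (k * \1_(h @^-1` [set k]) y)%:E)%E.
  under eq_integral do rewrite fimfunE -fsumEFin//.
  rewrite ge0_integral_fsum//.
  - by move=> k; apply/measurable_EFinP; exact: measurable_funM.
  - by move=> k y _; rewrite nnfun_muleindic_ge0.
transitivity (\sum_(k \in range h)
    \int[nu]_y ((k * \1_(h @^-1` [set k]) y)%:E * (g y)%:E))%E; last first.
  rewrite -ge0_integral_fsum//.
  - apply: eq_integral => y _; rewrite [in RHS]fimfunE -fsumEFin//.
    rewrite ge0_mule_fsuml// => k.
    by rewrite nnfun_muleindic_ge0.
  - move=> k; apply: emeasurable_funM => //.
    by apply/measurable_EFinP; exact: measurable_funM.
  - by move=> k y _; apply: mule_ge0; [rewrite nnfun_muleindic_ge0|rewrite lee_fin].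
apply: eq_fsbigr => k /[!inE] -[z _ <-].
rewrite integralZl_indic_nnsfun// integral_indic// setIT muE//.
under [RHS]eq_integral do rewrite EFinM -muleA.
rewrite ge0_integralZl_EFin//; first last.
- apply: emeasurable_funM => //.
  by apply/measurable_EFinP.
- by move=> y _; rewrite mule_ge0// lee_fin.
congr (_ * _)%E; rewrite integral_mkcond; apply: eq_integral => y _.
rewrite patchE indicE; case: ifPn => _; first by rewrite mul1e.
by rewrite mul0e.
Qed.

Lemma ge0_integral_density (phi : T -> \bar R) : measurable_fun setT phi ->
  (forall y, 0 <= phi y)%E ->
  (\int[mu]_y phi y = \int[nu]_y (phi y * (g y)%:E))%E.
Proof.
move=> mphi phi0.
have mgE : measurable_fun setT (EFin \o g) by exact/measurable_EFinP.
pose f_ := nnsfun_approx measurableT mphi.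
have cf y : ((f_ n y)%:E @[n --> \oo] --> phi y)%E.
  by apply: (@cvg_nnsfun_approx _ _ _ _ measurableT _ mphi) => //.
transitivity (limn (fun n => \int[mu]_y (f_ n y)%:E))%E.
  rewrite -monotone_convergence//.
  - by apply: eq_integral => y _; apply/esym/cvg_lim => //; exact: cf.
  - by move=> n; exact/measurable_EFinP.
  - by move=> n y _; rewrite lee_fin.
  - by move=> y _ m n mn; rewrite lee_fin; exact/lefP/nd_nnsfun_approx.
under eq_fun do rewrite nnsfun_integral_density.
rewrite -monotone_convergence//.
- apply: eq_integral => y _; apply/cvg_lim => //.
  apply: cvgeZr => //; exact: cf.
- by move=> n; apply: emeasurable_funM => //; exact/measurable_EFinP.
- by move=> n y _; rewrite mule_ge0// lee_fin.
- move=> y _ m n mn; rewrite lee_wpmul2r// ?lee_fin//.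
  exact/lefP/nd_nnsfun_approx.
Qed.

Lemma integrable_density (phi : T -> R) : measurable_fun setT phi ->
  nu.-integrable setT (fun y => (phi y * g y)%:E) ->
  mu.-integrable setT (EFin \o phi).
Proof.
move=> mphi /integrableP[_ hi]; apply/integrableP; split.
  exact/measurable_EFinP.
rewrite ge0_integral_density//.
- apply: le_lt_trans hi; rewrite le_eqVlt; apply/orP; left; apply/eqP.
  by apply: eq_integral => y _ /=; rewrite normrM (ger0_norm (g0 y)) EFinM.
- by apply: measurableT_comp => //; exact/measurable_EFinP.
Qed.

Lemma Rintegral_density (phi : T -> R) : measurable_fun setT phi ->
  nu.-integrable setT (fun y => (phi y * g y)%:E) ->
  \int[mu]_y phi y = \int[nu]_y (phi y * g y).
Proof.
move=> mphi iphi; congr fine.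
have mphiE : measurable_fun setT (EFin \o phi) by exact/measurable_EFinP.
(* Since g is nonnegative, taking positive and negative parts commutes with multiplication by g. *)
rewrite integralE [RHS]integralE; congr (_ - _)%E.
  rewrite ge0_integral_density//; last exact: measurable_funepos.
  apply: eq_integral => y _; rewrite !funeposE -!EFin_max -EFinM.
  by rewrite maxr_pMl// mul0r.
rewrite ge0_integral_density//; last exact: measurable_funeneg.
apply: eq_integral => y _; rewrite !funenegE -!EFinN -!EFin_max -EFinM.
by rewrite maxr_pMl// mul0r mulNr.
Qed.

End density.

Lemma cond_A1_pairwise_iid (R : realType) (d d' : measure_display)
    (Om : measurableType d) (P : probability Om R) (T : measurableType d')
    (Y : nat -> {RV P >-> T}) (nu : {measure set T -> \bar R}) (g : T -> R) :
  cond_A1 Y nu g -> pairwise_iid Y.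
Proof.
move=> [indY _ _ law]; split; first by move=> n B mB; rewrite !law.
move=> i j A B ij mA mB.
pose C k := if k == i then A else B.
have mC k : measurable (C k) by rewrite /C; case: ifP.
have := indY [fset i; j]%fset C mC.
have -> : \bigcap_(k in [set` [fset i; j]%fset]) (Y k @^-1` C k) =
    Y i @^-1` A `&` Y j @^-1` B.
  apply/seteqP; split => w.
    move=> h; split.
      by have := h i; rewrite /C eqxx; apply; rewrite /= !inE eqxx.
    have := h j; rewrite /C eq_sym (negbTE ij); apply.
    by rewrite /= !inE eqxx orbT.
  move=> [hA hB] k /=; rewrite !inE /C => /orP[/eqP ->|/eqP ->].
    by rewrite eqxx.
  by rewrite eq_sym (negbTE ij).
move=> ->.
rewrite big_fsetU1/= ?big_seq_fset1 ?inE// /C eqxx eq_sym (negbTE ij)//.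
Qed.

(* Countable dense subsets make the oscillation suprema below measurable. *)
Lemma compact_dense_seq (R : realType) (V : normedModType R) (S : set V) :
  compact S -> S !=set0 -> exists2 q : nat -> V, (forall k, S (q k)) &
    forall t r, S t -> 0 < r -> exists k, ball t r (q k).
Proof.
move=> cS [t0 St0].
have net (m : nat) : exists s : seq V, (forall x, x \in s -> S x) /\
    forall t, S t -> exists2 x, x \in s & ball x m.+1%:R^-1 t.
  have r0 : 0 < m.+1%:R^-1 :> R by rewrite invr_gt0.
  move: cS; rewrite compact_cover.
  move=> /(_ V S (fun x => (ball x m.+1%:R^-1)°)) [].
  - by move=> x _; exact: open_interior.
  - by move=> x Sx; exists x => //; exact: nbhsx_ballx.
  move=> J JS JC; exists (enum_fset J); split.
    by move=> x xJ; have := JS x xJ; rewrite inE.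
  move=> t /JC [x /= xJ xt]; exists x => //; exact: interior_subset xt.
have [s hs] := choice net.
(* [q] enumerates pairs (mesh level, position in the net of that level); codes that designate no
   point fall back on [t0], which lies in [S]. *)
pose q k := let mi : nat * nat := odflt (0%N, 0%N) (choice.unpickle k) in
  nth t0 (s mi.1) mi.2.
exists q.
  move=> k; rewrite /q; set mi := odflt _ _.
  have [h|h] := ltnP mi.2 (size (s mi.1)); last by rewrite nth_default.
  exact/(hs mi.1).1/mem_nth.
move=> t r St r0.
have [m] := ltr_add_invr r0; rewrite add0r => mr.
have [x xs xt] := (hs m).2 t St.
exists (choice.pickle (m, index x (s m))); rewrite /q choice.pickleK/= nth_index//.
by apply: ball_sym; apply: le_ball xt; exact: ltW.
Qed.

Lemma within_continuous_ball (R : realType) (V : normedModType R)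
    (S : set V) (f : V -> R) (t : V) (e : R) :
  {within S, continuous f} -> S t -> 0 < e ->
  exists2 r, 0 < r & forall u, S u -> ball t r u -> `|f t - f u| < e.
Proof.
move=> /subspace_continuousP cf St e0.
have /cvgrPdist_lt /(_ e e0) := cf t St.
rewrite near_withinE => /nbhs_ballP[r r0 hr].
by exists r => // u Su tu; exact: hr.
Qed.

(** * Uniform law for a dominated continuous family on a compact set *)

Section ulln.
Context d d' (Om : measurableType d) (T : measurableType d') (R : realType)
  (P : probability Om R) (Y : nat -> {RV P >-> T}).
Hypothesis iidY : pairwise_iid Y.
Let mu : probability T R := distribution P (Y 0%N).
Context (V : normedModType R) (S : set V) (F : T -> V -> R) (h : T -> R).
Hypotheses (cS : compact S)
  (mF : forall t, S t -> measurable_fun setT (F ^~ t))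
  (cF : forall y, {within S, continuous (F y)})
  (ih : mu.-integrable setT (EFin \o h))
  (Fh : forall y t, S t -> `|F y t| <= h y).

Let iF t : S t -> mu.-integrable setT (EFin \o (F ^~ t)).
Proof.
move=> St; apply: le_integrable ih => //.
  by apply/measurable_EFinP; exact: mF.
move=> y _ /=; rewrite lee_fin.
by rewrite (le_trans (Fh y St))// ler_norm.
Qed.

(** Wald's device: the oscillation of F y over a ball shrinking to t tends to 0 for each y by
    continuity and stays below 2 h, so its mean tends to 0 by dominated convergence. *)
Lemma local_modulus t e : S t -> 0 < e ->
  exists r (D : T -> R), [/\ 0 < r, mu.-integrable setT (EFin \o D),
    forall u, S u -> ball t r u -> forall y, `|F y t - F y u| <= D y &
    \int[mu]_y D y < e].
Proof.
move=> St e0.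
have S0 : S !=set0 by exists t.
have [q Sq dq] := compact_dense_seq cS S0.
(* A truth value replaces a restriction of the index set, so that [D m] is the supremum of one full
   sequence of measurable functions. *)
pose g (m k : nat) y : R := `[< ball t m.+1%:R^-1 (q k) >]%:R * `|F y t - F y (q k)|.
pose D m y := sups (g m ^~ y) 0%N.
have h0 y : 0 <= h y by exact: le_trans (Fh y St).
have g0 m k y : 0 <= g m k y by rewrite mulr_ge0.
have gh m k y : g m k y <= 2 * h y.
  rewrite /g; apply: (@le_trans _ _ `|F y t - F y (q k)|).
    by rewrite ler_piMl//; case: `[< _ >].
  rewrite (le_trans (ler_normB _ _))// mulr_natl mulr2n lerD//; exact: Fh.
have mg m k : measurable_fun setT (g m k).
  apply: measurable_funM => //; apply: measurableT_comp => //.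
  by apply: measurable_funB; exact: mF.
have ubg m y : has_ubound (range (g m ^~ y)).
  by exists (2 * h y) => _ [k _ <-].
have mD m : measurable_fun setT (D m).
  by apply: measurable_fun_sups => // y _; exact: ubg.
have gD m k y : g m k y <= D m y.
  apply: ub_le_sup; last by exists k.
  by exists (2 * h y) => _ [j _ <-].
have D0 m y : 0 <= D m y by exact: le_trans (g0 m 0%N y) (gD m 0%N y).
have Dle m y c : (forall k, g m k y <= c) -> D m y <= c.
  move=> gc; apply: ge_sup; first by exists (g m 0%N y); exists 0%N.
  by move=> _ [k _ <-].
have i2h : mu.-integrable setT (EFin \o (fun y => 2 * h y)).
  exact: (integrableZl measurableT 2 ih).
have Dh m y : D m y <= 2 * h y by exact: Dle.
have iD m : mu.-integrable setT (EFin \o D m).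
  apply: le_integrable i2h => //; first exact/measurable_EFinP.
  move=> y _ /=; rewrite !lee_fin ger0_norm// (le_trans (Dh m y))//.
  exact: ler_norm.
have D_cvg : (\int[mu]_y (D m y)%:E)%E @[m --> \oo] --> (\int[mu]_y (0 : \bar R))%E.
  have [] := @dominated_convergence _ T R mu setT measurableT
    (fun m y => (D m y)%:E) (cst 0%E) (fun y => (2 * h y)%:E) _ _ _ i2h _.
  - by move=> m; exact/measurable_EFinP.
  - exact: measurable_cst.
  - apply: aeW => y _; apply/fine_cvgP; split; first exact: nearW.
    apply/cvgrPdist_le => c c0.
    have [r r0 hr] := within_continuous_ball (@cF y) St c0.
    have [m mr] := ltr_add_invr r0; rewrite add0r in mr.
    exists m => // k /= mk; rewrite sub0r normrN ger0_norm//.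
    apply: Dle => j; rewrite /g; case: asboolP => [tq|_].
      rewrite mul1r ltW// hr//; apply: le_ball tq.
      by rewrite (le_trans _ (ltW mr))// lef_pV2 ?posrE// ler_nat ltnS.
    by rewrite mul0r ltW.
  - apply: aeW => y k _; rewrite lee_fin ger0_norm//; exact: Dh.
  - by [].
rewrite integral0 in D_cvg.
have [m hm] : exists m, \int[mu]_y D m y < e.
  have /fine_cvgP[_ /cvgrPdist_lt /(_ e e0)[m _ /(_ m (leqnn m))]] := D_cvg.
  rewrite sub0r normrN => /(le_lt_trans (ler_norm _)) hm.
  by exists m.
(* Halving the radius leaves room to replace u by a nearby point of the dense sequence that is still
   in the ball defining [D m]; continuity at u makes the replacement error arbitrarily small. *)
exists (m.+1%:R^-1 / 2), (D m); split => // u Su tu y.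
apply/ler_addgt0Pr => c c0.
have [r r0 hr] := within_continuous_ball (@cF y) Su c0.
pose r' := Num.min r (m.+1%:R^-1 / 2).
have r'0 : 0 < r' by rewrite lt_min r0/= divr_gt0// invr_gt0.
have [k uk] := dq u r' Su r'0.
have tk : ball t m.+1%:R^-1 (q k).
  rewrite [X in ball _ X](splitr m.+1%:R^-1); apply: ball_triangle tu _.
  by apply: le_ball uk; rewrite ge_min lexx orbT.
have h1 : `|F y t - F y (q k)| <= D m y.
  by apply: le_trans (gD m k y); rewrite /g asboolT// mul1r.
have h2 : `|F y (q k) - F y u| <= c.
  by rewrite distrC ltW// hr//; apply: le_ball uk; rewrite ge_min lexx.
by rewrite (le_trans (ler_distD (F y (q k)) _ _))// lerD.
Qed.

Lemma integral_within_continuous :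
  {within S, continuous (fun t => \int[mu]_y F y t)}.
Proof.
apply/subspace_continuousP => t St; apply/cvgrPdist_lt => e e0.
have [r [D [r0 iD FD De]]] := local_modulus St e0.
rewrite near_withinE; apply/nbhs_ballP; exists r => // u tu Su.
rewrite -RintegralB//; [|exact: iF|exact: iF].
have iFF : mu.-integrable setT (EFin \o (fun y => F y t - F y u)).
  exact: (integrableB measurableT (iF St) (iF Su)).
apply: le_lt_trans (le_normr_Rintegral measurableT iFF) _.
apply: le_lt_trans De; apply: le_Rintegral => //.
- exact: integrable_norm.
- by move=> y _; exact: FD.
Qed.

Lemma ae_near_all_in (I : eqType) (s : seq I) (Q : I -> Om -> nat -> Prop) :
  (forall i, i \in s -> {ae P, forall w, \forall n \near \oo, Q i w n}) ->
  {ae P, forall w, \forall n \near \oo, forall i, i \in s -> Q i w n}.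
Proof.
elim: s => [|i s ih' hs]; first by move=> _; apply: aeW => w; exact: nearW.
have h1 := hs i (mem_head _ _).
have h2 : {ae P, forall w, \forall n \near \oo, forall j, j \in s -> Q j w n}.
  by apply: ih' => j js; apply: hs; rewrite inE js orbT.
apply: filterS2 h1 h2 => w; apply: filterS2 => n hi hj j.
by rewrite inE => /orP[/eqP ->|/hj].
Qed.

(** Compactness leaves finitely many centres, and the strong law is applied only to F at the centres
    and to their moduli. Within each ball the modulus controls both the empirical mean and the
    expectation. *)
Lemma ulln_eps e : 0 < e -> {ae P, forall w, \forall n \near \oo,
  forall t, S t ->
    `|\int[mu]_y F y t - n%:R^-1 * (\sum_(i < n) F (Y i w) t)| <= e}.
Proof.
move=> e0; pose c := e / 4.
have c0 : 0 < c by rewrite divr_gt0.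
pose good (t : V) (rD : R * (T -> R)) := S t ->
  [/\ 0 < rD.1, mu.-integrable setT (EFin \o rD.2),
    forall u, S u -> ball t rD.1 u -> forall y, `|F y t - F y u| <= rD.2 y &
    \int[mu]_y rD.2 y < c].
have exgood t : exists rD, good t rD.
  have [St|nSt] := pselect (S t).
    by have [r [D ?]] := local_modulus St c0; exists (r, D).
  by exists (0, fun=> 0).
have [rD hrD] := choice exgood.
have := cS; rewrite compact_cover.
move=> /(_ V S (fun x => (ball x (rD x).1)°)) [].
- by move=> x _; exact: open_interior.
- move=> x Sx; exists x => //.
  by have [r0 _ _ _] := hrD x Sx; exact: nbhsx_ballx.
move=> J JS JC.
have : {ae P, forall w, \forall n \near \oo, forall t, t \in enum_fset J ->
   n%:R^-1 * (\sum_(i < n) (rD t).2 (Y i w)) <= c /\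
   `|\int[mu]_y F y t - n%:R^-1 * (\sum_(i < n) F (Y i w) t)| <= c}.
  apply: ae_near_all_in => t tJ.
  have St : S t by have := JS t tJ; rewrite inE.
  have [_ iD _ Dc] := hrD t St.
  have hD := iid_slln iidY iD; have hF := iid_slln iidY (iF St).
  apply: filterS2 hD hF => w hD hF.
  near=> n; split.
    by apply: ltW; near: n; exact: (cvgr_lt _ hD).
  by near: n; move/cvgrPdist_le : hF; exact.
apply: filterS => w [N _ hN]; exists N => // n Nn t St.
have [x /= xJ /interior_subset xt] := JC t St.
have Sx : S x by have := JS x xJ; rewrite inE.
have [r0 iD FD Dc] := hrD x Sx.
have [h1 h2] := hN n Nn x xJ.
have h3 : `|\int[mu]_y F y t - \int[mu]_y F y x| <= c.
  rewrite -RintegralB//; [|exact: iF|exact: iF].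
  have iFF : mu.-integrable setT (EFin \o (fun y => F y t - F y x)).
    exact: (integrableB measurableT (iF St) (iF Sx)).
  apply: le_trans (le_normr_Rintegral measurableT iFF) _.
  apply: le_trans (ltW Dc); apply: le_Rintegral => //.
  - exact: integrable_norm.
  - by move=> y _; rewrite distrC; exact: FD.
have h4 : `|n%:R^-1 * (\sum_(i < n) F (Y i w) x) -
            n%:R^-1 * (\sum_(i < n) F (Y i w) t)| <= c.
  apply: le_trans h1; rewrite -mulrBr normrM ger0_norm ?invr_ge0//.
  rewrite ler_wpM2l ?invr_ge0// -sumrB (le_trans (ler_norm_sum _ _ _))//.
  by apply: ler_sum => i _; exact: FD.
apply: le_trans (ler_distD (\int[mu]_y F y x) _ _) _.
apply: le_trans (lerD h3 (ler_distD (n%:R^-1 * (\sum_(i < n) F (Y i w) x)) _ _)) _.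
apply: le_trans (lerD (lexx _) (lerD h2 h4)) _.
by rewrite /c; lra.
Unshelve. all: by end_near. Qed.

Lemma ulln : {ae P, forall w (e : R), 0 < e -> \forall n \near \oo,
  forall t, S t ->
    `|\int[mu]_y F y t - n%:R^-1 * (\sum_(i < n) F (Y i w) t)| <= e}.
Proof.
have : {ae P, forall w, forall k : nat, \forall n \near \oo, forall t, S t ->
    `|\int[mu]_y F y t - n%:R^-1 * (\sum_(i < n) F (Y i w) t)| <= k.+1%:R^-1}.
  by apply: ae_foralln => k; apply: ulln_eps; rewrite invr_gt0.
apply: filterS => w hw e e0; have [k] := ltr_add_invr e0; rewrite add0r => ke.
apply: filterS (hw k) => n hn t St; exact: le_trans (hn t St) (ltW ke).
Qed.

End ulln.

(** The moving point is compared with t through the limit G alone. In this form the uniform laws are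
    evaluated at the estimators and at the intermediate points of the expansion. *)
Lemma uniform_cvg_at (R : realType) (V : normedModType R) (S : set V)
    (G_ : nat -> V -> R) (G : V -> R) (t_ : nat -> V) (t : V) :
  {within S, continuous G} ->
  (forall e, 0 < e -> \forall n \near \oo, forall t, S t -> `|G t - G_ n t| <= e) ->
  S t -> (\forall n \near \oo, S (t_ n)) -> t_ n @[n --> \oo] --> t ->
  G_ n (t_ n) @[n --> \oo] --> G t.
Proof.
move=> cG hG St St_ t_t; apply/cvgrPdist_le => e e0.
have e20 : 0 < e / 2 by rewrite divr_gt0.
have [r r0 hr] := within_continuous_ball cG St e20.
near=> n.
have Sn : S (t_ n) by near: n.
apply: le_trans (ler_distD (G (t_ n)) _ _) _.
rewrite (splitr e) lerD//.
  rewrite ltW// hr//; near: n; apply: t_t; exact: nbhsx_ballx.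
by move: (t_ n) Sn; near: n; exact: hG.
Unshelve. all: by end_near. Qed.

(** * Directional derivatives *)

Section directional.
Context (R : realType) (V : normedModType R).
Implicit Types (f : V -> R) (a v : V).

Lemma is_derive_line f a v (s : R) : derivable f (a + s *: v) v ->
  is_derive s 1 (fun t : R => f (a + t *: v)) ('D_v f (a + s *: v)).
Proof.
move=> df.
have E : (fun h : R => h^-1 *: (((fun t : R => f (a + t *: v)) \o shift s) (h *: 1) -
      f (a + s *: v))) =
    (fun h : R => h^-1 *: ((f \o shift (a + s *: v)) (h *: v) - f (a + s *: v))).
  apply/funext => h /=; congr (_ *: (f _ - _)).
  by rewrite [h *: 1]mulr1 scalerDl addrCA addrA.
by apply: DeriveDef; rewrite /derivable /derive E.
Qed.

Lemma line_MVT f a v :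
  (forall s : R, 0 <= s <= 1 -> differentiable f (a + s *: v)) ->
  exists2 s : R, 0 <= s <= 1 & f (a + v) - f a = 'D_v f (a + s *: v).
Proof.
move=> df.
have dg (s : R) : 0 <= s <= 1 ->
    is_derive s 1 (fun t : R => f (a + t *: v)) ('D_v f (a + s *: v)).
  by move=> hs; apply: is_derive_line; apply: diff_derivable; exact: df.
have [] := @MVT R (fun t : R => f (a + t *: v))
  (fun s => 'D_v f (a + s *: v)) 0 1 ltr01.
- by move=> s; rewrite in_itv/= => /andP[s0 s1]; apply: dg; rewrite !ltW.
- apply/derivable_within_continuous => s; rewrite in_itv/= => hs.
  by have [] := dg s hs.
- move=> s; rewrite in_itv/= => /andP[s0 s1].
  by rewrite scale1r scale0r addr0 subr0 mulr1 => ->; exists s; rewrite ?ltW.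
Qed.

Lemma derive_local_max f a v :
  (\forall x \near a, derivable f x v /\ f x <= f a) -> 'D_v f a = 0.
Proof.
move=> /nbhs_ballP[r r0 hr].
(* For |s| < c the point a + s v stays in the ball of radius r; the 1 covers the case v = 0. *)
pose c := r / (`|v| + 1).
have v0 : 0 < `|v| + 1 by rewrite ltr_wpDl.
have c0 : 0 < c by rewrite divr_gt0.
have hb (s : R) : s \in `](- c), c[%R -> ball a r (a + s *: v).
  rewrite in_itv/= -ltr_norml -ball_normE/= opprD addNKr normrN normrZ => sc.
  apply: (@le_lt_trans _ _ (`|s| * (`|v| + 1))).
    by rewrite ler_wpM2l// lerDl.
  by rewrite -ltr_pdivlMr.
have a0 : a + 0 *: v = a by rewrite scale0r addr0.
have h0 : 0 \in `](- c), c[%R by rewrite in_itv/= oppr_lt0 c0.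
have dg (s : R) : s \in `](- c), c[%R ->
    is_derive s 1 (fun t : R => f (a + t *: v)) ('D_v f (a + s *: v)).
  by move=> /hb/hr[? _]; exact: is_derive_line.
have [_ d0] : is_derive (0 : R) 1 (fun t : R => f (a + t *: v)) 0.
  apply: (@derive1_at_max _ _ (- c) c) => //.
  - by rewrite (le_trans _ (ltW c0))// oppr_le0 ltW.
  - by move=> t tc; have [] := dg t tc.
  - by move=> t /hb/hr[_]; rewrite a0.
by have [_] := dg 0 h0; rewrite d0 a0.
Qed.

End directional.

(** * Partial derivatives and Schwarz's theorem *)

Section partial_derivatives.
Context (R : realType) (p : nat).
Implicit Types (f : 'cV[R]_p -> R) (a v : 'cV[R]_p).

Lemma derive_partials f a v : differentiable f a ->
  'D_v f a = \sum_j v j 0 * 'D_(delta_mx j 0) f a.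
Proof.
move=> df; rewrite deriveE// [in LHS](matrix_sum_delta v).
rewrite linear_sum; apply: eq_bigr => j _.
by rewrite big_ord1 linearZ/= -deriveE.
Qed.

Lemma derive_translate f a b v : 'D_v (fun x => f (x + b)) a = 'D_v f (a + b).
Proof.
have E : (fun h : R => h^-1 *: (((fun x => f (x + b)) \o shift a) (h *: v) -
      f (a + b))) =
    (fun h : R => h^-1 *: ((f \o shift (a + b)) (h *: v) - f (a + b))).
  by apply/funext => h /=; rewrite addrA.
by rewrite /derive E.
Qed.

Lemma differentiable_translate f a b : differentiable f (a + b) ->
  differentiable (fun x => f (x + b)) a.
Proof.
move=> df; apply: (@differentiable_comp _ _ _ _ (fun x => x + b) f) => //.
Qed.

(** The second difference is the increment along u of x -> f(x + v) - f(x). The mean value theorem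
    along u turns it into an increment of g along v, and a second application gives the derivative
    of g. *)
Lemma second_difference (f g : 'cV[R]_p -> R) a (u v : 'cV[R]_p) :
  (forall s t : R, 0 <= s <= 1 -> 0 <= t <= 1 ->
    [/\ differentiable f (a + s *: u + t *: v),
        'D_u f (a + s *: u + t *: v) = g (a + s *: u + t *: v) &
        differentiable g (a + s *: u + t *: v)]) ->
  exists s t : R, [/\ 0 <= s <= 1, 0 <= t <= 1 &
    f (a + u + v) - f (a + u) - (f (a + v) - f a) =
    'D_v g (a + s *: u + t *: v)].
Proof.
move=> hfg.
have I1 : (0 : R) <= (1 : R) <= (1 : R) by rewrite ler01 /=.
have I0 : (0 : R) <= (0 : R) <= (1 : R) by rewrite ler01 andbT.
have h1 (s : R) : 0 <= s <= 1 -> differentiable f (a + s *: u + v) /\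
    'D_u f (a + s *: u + v) = g (a + s *: u + v).
  by move=> hs; have [] := hfg s 1 hs I1; rewrite scale1r.
have h0 (s : R) : 0 <= s <= 1 -> differentiable f (a + s *: u) /\
    'D_u f (a + s *: u) = g (a + s *: u).
  by move=> hs; have [] := hfg s 0 hs I0; rewrite scale0r addr0.
pose F x := f (x + v) - f x.
have [s hs Fs] : exists2 s : R, 0 <= s <= 1 &
    F (a + u) - F a = 'D_u F (a + s *: u).
  apply: line_MVT => s hs; apply: differentiableB; last exact: (h0 s hs).1.
  by apply: differentiable_translate; exact: (h1 s hs).1.
have [t ht Ft] : exists2 t : R, 0 <= t <= 1 &
    g (a + s *: u + v) - g (a + s *: u) = 'D_v g (a + s *: u + t *: v).
  by apply: line_MVT => t ht; have [] := hfg s t hs ht.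
exists s, t; split => //.
rewrite -Ft -(h1 s hs).2 -(h0 s hs).2.
rewrite -[LHS]/(F (a + u) - F a) Fs /F deriveB.
- by rewrite derive_translate.
- by apply/diff_derivable/differentiable_translate; exact: (h1 s hs).1.
- by apply: diff_derivable; exact: (h0 s hs).1.
Qed.

(** The second difference over a small parallelogram is symmetric in its two sides. Computed in both
    orders it gives h^2 times either mixed derivative at points close to a, and continuity at a
    removes the displacement. *)
Lemma schwarz (f fi fj : 'cV[R]_p -> R) a (i j : 'I_p) :
  (\forall x \near a, differentiable f x /\
     ('D_(delta_mx i 0) f x = fi x /\ differentiable fi x) /\
     ('D_(delta_mx j 0) f x = fj x /\ differentiable fj x)) ->
  {for a, continuous (fun x => 'D_(delta_mx j 0) fi x)} ->
  {for a, continuous (fun x => 'D_(delta_mx i 0) fj x)} ->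
  'D_(delta_mx j 0) fi a = 'D_(delta_mx i 0) fj a.
Proof.
move=> df cji cij.
have [fji fjiE] : exists F, forall x, 'D_(delta_mx j 0) fi x = F x.
  by exists (fun x => 'D_(delta_mx j 0) fi x).
have [fij fijE] : exists F, forall x, 'D_(delta_mx i 0) fj x = F x.
  by exists (fun x => 'D_(delta_mx i 0) fj x).
have {}cji : {for a, continuous fji}.
  by rewrite (_ : fji = fun x => 'D_(delta_mx j 0) fi x) //; apply/funext.
have {}cij : {for a, continuous fij}.
  by rewrite (_ : fij = fun x => 'D_(delta_mx i 0) fj x) //; apply/funext.
rewrite fjiE fijE.
apply/eqP; rewrite -subr_eq0; apply/eqP/normr0_eq0/eqP.
rewrite eq_le normr_ge0 andbT; apply/ler_addgt0Pr => e e0; rewrite add0r.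
have e20 : 0 < e / 2 by rewrite divr_gt0.
have /cvgrPdist_lt/(_ _ e20) nji := cji.
have /cvgrPdist_lt/(_ _ e20) nij := cij.
have [r r0 hr] : exists2 r : R, 0 < r & forall x, ball a r x ->
  [/\ differentiable f x,
     'D_(delta_mx i 0) f x = fi x /\ differentiable fi x,
     'D_(delta_mx j 0) f x = fj x /\ differentiable fj x,
     `|fji a - fji x| < e / 2 & `|fij a - fij x| < e / 2].
  have : \forall x \near a, [/\ differentiable f x,
     'D_(delta_mx i 0) f x = fi x /\ differentiable fi x,
     'D_(delta_mx j 0) f x = fj x /\ differentiable fj x,
     `|fji a - fji x| < e / 2 & `|fij a - fij x| < e / 2].
    by apply: filterS3 df nji nij => x [d1 [d2 d3]] h1 h2; exact: And5.
  by move=> /nbhs_ballP[r r0 hr]; exists r.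
(* With h = r / N the parallelogram with sides h e_i and h e_j at a lies in the ball of radius r;
   the 1 makes [N] positive and the inclusion strict. *)
pose N := `|delta_mx i 0 : 'cV[R]_p| + `|delta_mx j 0 : 'cV[R]_p| + 1.
have N0 : 0 < N by rewrite ltr_wpDl.
have [h h0 hE] : exists2 h : R, 0 < h & r = h * N.
  by exists (r / N); [rewrite divr_gt0|rewrite divfK// gt_eqF].
have hge0 : 0 <= h by exact: ltW.
pose ei := h *: (delta_mx i 0 : 'cV[R]_p); pose ej := h *: (delta_mx j 0 : 'cV[R]_p).
have hball (s t : R) : 0 <= s <= 1 -> 0 <= t <= 1 ->
    ball a r (a + s *: ei + t *: ej).
  move=> /andP[s0 s1] /andP[t0 t1]; rewrite -ball_normE/= -addrA opprD addNKr normrN.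
  apply: le_lt_trans (ler_normD _ _) _.
  rewrite /ei /ej !normrZ (ger0_norm hge0) (ger0_norm s0) (ger0_norm t0).
  apply: (@le_lt_trans _ _ 
    (h * `|delta_mx i 0 : 'cV[R]_p| + h * `|delta_mx j 0 : 'cV[R]_p|)).
    by rewrite lerD// ler_piMl// (mulr_ge0 hge0).
  by rewrite hE -mulrDr ltr_pM2l// /N ltrDl.
have hball' (s t : R) : 0 <= s <= 1 -> 0 <= t <= 1 ->
    ball a r (a + s *: ej + t *: ei).
  by move=> hs ht; rewrite -addrA (addrC (s *: _)) addrA; exact: hball.
have scale_deriv (g : 'cV[R]_p -> R) x v : differentiable g x ->
    'D_(h *: v) g x = h * 'D_v g x.
  by move=> dg; rewrite !deriveE// linearZ.
have scale_deriv2 (l : 'I_p) (g : 'cV[R]_p -> R) x : differentiable g x ->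
    'D_(h *: delta_mx l 0) (h \*: g) x = h * (h * 'D_(delta_mx l 0) g x).
  move=> dg; rewrite deriveZ; last exact: diff_derivable.
  by rewrite scale_deriv.
have [s1 [t1 [hs1 ht1 E1]]] : exists s t : R, [/\ 0 <= s <= 1, 0 <= t <= 1 &
    f (a + ei + ej) - f (a + ei) - (f (a + ej) - f a) =
    'D_ej (h \*: fi) (a + s *: ei + t *: ej)].
  apply: second_difference => s' t' hs ht.
  have [df1 [fiE dfi] _ _ _] := hr _ (hball s' t' hs ht); split; first exact: df1.
    by rewrite /ei scale_deriv// fiE.
  exact: differentiableZ.
have [s2 [t2 [hs2 ht2 E2]]] : exists s t : R, [/\ 0 <= s <= 1, 0 <= t <= 1 &
    f (a + ej + ei) - f (a + ej) - (f (a + ei) - f a) =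
    'D_ei (h \*: fj) (a + s *: ej + t *: ei)].
  apply: second_difference => s' t' hs ht.
  have [df1 _ [fjE dfj] _ _] := hr _ (hball' s' t' hs ht); split; first exact: df1.
    by rewrite /ej scale_deriv// fjE.
  exact: differentiableZ.
have [_ [_ di] _ c1 _] := hr _ (hball s1 t1 hs1 ht1).
have [_ _ [_ dj] _ c2] := hr _ (hball' s2 t2 hs2 ht2).
rewrite scale_deriv2// fjiE in E1; rewrite scale_deriv2// fijE in E2.
have E3 : f (a + ei + ej) - f (a + ei) - (f (a + ej) - f a) =
          f (a + ej + ei) - f (a + ej) - (f (a + ei) - f a).
  by rewrite (addrAC a ei ej); ring.
have hn0 : h != 0 by rewrite gt_eqF.
move: E1; rewrite E3 E2 => /(mulfI hn0)/(mulfI hn0) E.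
rewrite -E in c1.
apply: le_trans (ler_distD (fij (a + s2 *: ej + t2 *: ei)) _ _) _.
by rewrite (distrC _ (fij a)) [leRHS]splitr lerD// ltW.
Qed.

End partial_derivatives.

(** * Limits of matrices and quadratic forms *)

Section matrix_limits.
Context (R : realType).

Lemma cvg_big_sum (I : Type) (r : seq I) (u : I -> nat -> R) (l : I -> R) :
  (forall i, u i n @[n --> \oo] --> l i) ->
  \sum_(i <- r) u i n @[n --> \oo] --> \sum_(i <- r) l i.
Proof.
move=> ul; elim: r => [|i r ih].
  by rewrite big_nil; under eq_fun do rewrite big_nil; exact: cvg_cst.
by rewrite big_cons; under eq_fun do rewrite big_cons; exact: cvgD.
Qed.

Lemma cvg_big_prod (I : Type) (r : seq I) (u : I -> nat -> R) (l : I -> R) :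
  (forall i, u i n @[n --> \oo] --> l i) ->
  \prod_(i <- r) u i n @[n --> \oo] --> \prod_(i <- r) l i.
Proof.
move=> ul; elim: r => [|i r ih].
  by rewrite big_nil; under eq_fun do rewrite big_nil; exact: cvg_cst.
by rewrite big_cons; under eq_fun do rewrite big_cons; exact: cvgM.
Qed.

(** Convergence is entrywise so that products, determinants and cofactors reduce to sums and
    products of real limits. *)
Definition mx_cvg m k (M_ : nat -> 'M[R]_(m, k)) (M : 'M[R]_(m, k)) : Prop :=
  forall i j, M_ n i j @[n --> \oo] --> M i j.

Lemma mx_cvg_mul m k l (A_ : nat -> 'M[R]_(m, k)) A (B_ : nat -> 'M[R]_(k, l)) B :
  mx_cvg A_ A -> mx_cvg B_ B -> mx_cvg (fun n => A_ n *m B_ n) (A *m B).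
Proof.
move=> hA hB i j; rewrite mxE; under eq_fun do rewrite mxE.
by apply: cvg_big_sum => s; apply: cvgM.
Qed.

Lemma mx_cvg_tr m k (A_ : nat -> 'M[R]_(m, k)) A :
  mx_cvg A_ A -> mx_cvg (fun n => (A_ n)^T) A^T.
Proof. by move=> hA i j; rewrite mxE; under eq_fun do rewrite mxE; exact: hA. Qed.

Lemma cvg_det k (A_ : nat -> 'M[R]_k) A :
  mx_cvg A_ A -> \det (A_ n) @[n --> \oo] --> \det A.
Proof.
move=> hA; apply: cvg_big_sum => s; apply: cvgM; first exact: cvg_cst.
by apply: cvg_big_prod => i; exact: hA.
Qed.

(** Cramer's rule writes the inverse as cofactors over the determinant. It describes [invmx] only at
    invertible matrices, hence the detour through large n, where the determinant is nonzero. *)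
Lemma mx_cvg_inv k (A_ : nat -> 'M[R]_k) A : A \in unitmx ->
  mx_cvg A_ A -> mx_cvg (fun n => invmx (A_ n)) (invmx A).
Proof.
move=> uA hA i j.
have dA : \det A != 0 by rewrite -unitfE -unitmxE.
have hd := cvg_det hA.
have nu : \forall n \near \oo, (\det (A_ n))^-1 * cofactor (A_ n) j i = invmx (A_ n) i j.
  have : \forall n \near \oo, \det (A_ n) != 0.
    have := cvgr_neq0 _ hd dA; exact.
  apply: filterS => n dn; rewrite /invmx unitmxE unitfE dn.
  by rewrite !mxE.
have -> : invmx A i j = (\det A)^-1 * cofactor A j i.
  by rewrite /invmx uA !mxE.
apply: cvg_trans; first exact: (near_eq_cvg nu).
apply: cvgM; first exact: cvgV.
apply: cvgM; first exact: cvg_cst.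
by apply: cvg_det => s t; rewrite !mxE; under eq_fun do rewrite !mxE; exact: hA.
Qed.

End matrix_limits.

Section quadratic_forms.
Context (R : realType).

Lemma discriminant_le (a b d : R) : 0 <= d ->
  (forall t, 0 <= a + 2 * t * b + t ^+ 2 * d) -> b ^+ 2 <= d * a.
Proof.
move=> d0 h; have [d_gt0|] := ltP 0 d.
  have := h (- b / d).
  have -> : a + 2 * (- b / d) * b + (- b / d) ^+ 2 * d = (d * a - b ^+ 2) / d.
    by field; rewrite gt_eqF.
  by rewrite pmulr_lge0 ?invr_gt0// subr_ge0.
move=> d_le0; have d_eq0 : d = 0 by apply/le_anti; rewrite d_le0.
rewrite d_eq0 mul0r; have [->|b0] := eqVneq b 0; first by rewrite expr0n.
(* For d = 0 the expression is affine in t, and at this t it equals -1. *)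
have := h (- (a + 1) / (2 * b)).
have -> : a + 2 * (- (a + 1) / (2 * b)) * b + (- (a + 1) / (2 * b)) ^+ 2 * d = - 1.
  by rewrite d_eq0 mulr0 addr0; field.
by rewrite ler0N1.
Qed.

(** The form at w + t e_i is a nonnegative quadratic polynomial in t; the claim is the sign of its
    discriminant. *)
Lemma psd_row_bound p (B : 'M[R]_p) (w : 'cV[R]_p) (i : 'I_p) :
  B^T = B -> (forall v : 'cV[R]_p, 0 <= (v^T *m B *m v) 0 0) ->
  ((B *m w) i 0) ^+ 2 <= B i i * (w^T *m B *m w) 0 0.
Proof.
move=> Bsym Bpsd; pose e : 'cV[R]_p := delta_mx i 0.
have eB (v : 'cV[R]_p) : (e^T *m B *m v) 0 0 = (B *m v) i 0.
  rewrite -mulmxA mxE (bigD1 i)//= big1 ?addr0.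
    by rewrite !mxE !eqxx mul1r.
  by move=> k ki; rewrite !mxE (negbTE ki) mul0r.
have Bii : (e^T *m B *m e) 0 0 = B i i.
  rewrite eB mxE (bigD1 i)//= big1 ?addr0; first by rewrite !mxE !eqxx mulr1.
  by move=> k ki; rewrite !mxE (negbTE ki) mulr0.
have we : (w^T *m B *m e) 0 0 = (e^T *m B *m w) 0 0.
  have -> : w^T *m B *m e = (e^T *m B *m w)^T.
    by rewrite !trmx_mul trmxK Bsym mulmxA.
  by rewrite mxE.
apply: discriminant_le; first by rewrite -Bii.
move=> t; have := Bpsd (w + t *: e).
have -> : (w + t *: e)^T = w^T + t *: e^T.
  by apply/matrixP => k l; rewrite !mxE.
rewrite !mulmxDl !mulmxDr -!scalemxAl -!scalemxAr.
have -> (X1 X2 X3 X4 : 'M[R]_1) : (X1 + t *: X2 + (t *: X3 + t *: (t *: X4))) 0 0 =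
    X1 0 0 + t * X2 0 0 + (t * X3 0 0 + t * (t * X4 0 0)) by rewrite !mxE.
rewrite we Bii eB.
by congr (0 <= _); ring.
Qed.

(* Cauchy-Schwarz for the semi-definite form B between the basis vector e_i and
   invmx B *m z. *)
Lemma pivot_bound p (B : 'M[R]_p) (z : 'cV[R]_p) (i : 'I_p) : B \in unitmx ->
  B^T = B -> (forall v : 'cV[R]_p, 0 <= (v^T *m B *m v) 0 0) ->
  (z i 0) ^+ 2 <= B i i * (z^T *m invmx B *m z) 0 0.
Proof.
move=> uB Bsym Bpsd; have := psd_row_bound (invmx B *m z) i Bsym Bpsd.
rewrite mulmxA mulmxV// mul1mx; congr (_ <= _ * _ 0 0).
by rewrite trmx_mul trmx_inv Bsym -!mulmxA (mulmxA B) mulmxV// mul1mx.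
Qed.

Lemma mx_entry_norm m k (A : 'M[R]_(m, k)) i j : `|A i j| <= `|A|.
Proof.
rewrite [leRHS]/Num.norm/= mx_normrE.
exact: (@le_bigmax _ _ _ 0 (fun ij => `|A ij.1 ij.2|) (i, j)).
Qed.

Lemma mx_norm_le m k (A : 'M[R]_(m, k)) c : 0 <= c ->
  (forall i j, `|A i j| <= c) -> `|A| <= c.
Proof.
move=> c0 h; rewrite [leLHS]/Num.norm/= mx_normrE.
by apply/bigmax_leP; split => // -[i j] _; exact: h.
Qed.

Lemma mx_norm_mul m k l (A : 'M[R]_(m, k)) (B : 'M[R]_(k, l)) :
  `|A *m B| <= k%:R * (`|A| * `|B|).
Proof.
apply: mx_norm_le; first by rewrite !mulr_ge0.
move=> i j; rewrite mxE (le_trans (ler_norm_sum _ _ _))//.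
apply: (@le_trans _ _ (\sum_(s < k) `|A| * `|B|)).
  by apply: ler_sum => s _; rewrite normrM ler_pM// mx_entry_norm.
by rewrite sumr_const card_ord mulr_natl.
Qed.

Lemma mx_cvg_norm m k (A_ : nat -> 'M[R]_(m, k)) A :
  mx_cvg A_ A -> `|A_ n - A| @[n --> \oo] --> 0.
Proof.
move=> hA; apply/cvgrPdist_le => e e0.
have : \forall n \near \oo, forall ij,
    ij \in enum (Finite.clone _ ('I_m * 'I_k)%type) ->
    `|A_ n ij.1 ij.2 - A ij.1 ij.2| <= e.
  elim: (enum _) => [|ij s ih]; first exact: nearW.
  have h : \forall n \near \oo, `|A_ n ij.1 ij.2 - A ij.1 ij.2| <= e.
    move/cvgrPdist_le : (hA ij.1 ij.2) => /(_ e e0).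
    by apply: filterS => n; rewrite distrC.
  apply: filterS2 h ih => n h1 h2 kl; rewrite inE => /orP[/eqP ->//|]; exact: h2.
apply: filterS => n hn; rewrite sub0r normrN normr_id.
apply: mx_norm_le; first exact: ltW.
by move=> i j; rewrite !mxE; apply: (hn (i, j)); rewrite mem_enum.
Qed.

Lemma enorm_le p (v : 'cV[R]_p) : enorm v <= Num.sqrt p%:R * `|v|.
Proof.
have -> : Num.sqrt p%:R * `|v| = Num.sqrt (p%:R * `|v| ^+ 2).
  by rewrite sqrtrM// sqrtr_sqr normr_id.
apply: ler_wsqrtr.
apply: (@le_trans _ _ (\sum_(i < p) `|v| ^+ 2)).
  apply: ler_sum => i _; rewrite -(real_normK (num_real (v i 0))).
  by rewrite lerXn2r// ?nnegrE// mx_entry_norm.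
by rewrite sumr_const card_ord mulr_natl.
Qed.

End quadratic_forms.

(** * Comparison of two quadratic equations with a common limit *)

Section solution_distance.
Context (R : realType) (p : nat).

Lemma inv_form_ge0 (B : 'M[R]_p) (z : 'cV[R]_p) : B \in unitmx -> B^T = B ->
  (forall v : 'cV[R]_p, 0 <= (v^T *m B *m v) 0 0) ->
  0 <= (z^T *m invmx B *m z) 0 0.
Proof.
move=> uB sB pB; have := pB (invmx B *m z).
by rewrite trmx_mul trmx_inv sB -!mulmxA (mulmxA B) mulmxV// mul1mx.
Qed.

(** An upper bound on B is a lower bound on its inverse. As the norm is the sup norm, the
    coordinatewise [pivot_bound] is enough. *)
Lemma inv_form_norm (B : 'M[R]_p) (z : 'cV[R]_p) C : B \in unitmx -> B^T = B ->
  (forall v : 'cV[R]_p, 0 <= (v^T *m B *m v) 0 0) -> `|B| <= C ->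
  `|z| ^+ 2 <= C * (z^T *m invmx B *m z) 0 0.
Proof.
move=> uB sB pB BC; set q := (_ *m _) 0 0.
have q0 : 0 <= q by exact: inv_form_ge0.
have C0 : 0 <= C by exact: le_trans (normr_ge0 _) BC.
have Cq0 : 0 <= C * q by exact: mulr_ge0.
have : `|z| <= Num.sqrt (C * q).
  apply: mx_norm_le; first exact: sqrtr_ge0.
  move=> i j; rewrite ord1 -sqrtr_sqr; apply: ler_wsqrtr.
  apply: le_trans (pivot_bound z i uB sB pB) _; apply: ler_wpM2r => //.
  by apply: le_trans BC; apply: le_trans (mx_entry_norm B i i); exact: ler_norm.
move=> /(@lerXn2r _ 2); rewrite !nnegrE sqr_sqrtr//; apply => //.
Qed.

(** Write u = A^-1 A' u - A^-1 (A' - A) u: the last term is at most |u| / 2 and is absorbed on the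
    left. The powers of p appear because the sup norm is submultiplicative only up to the
    dimension. *)
Lemma norm_le_perturbed (A A' : 'M[R]_p) (u : 'cV[R]_p) : A \in unitmx ->
  p%:R ^+ 2 * `|invmx A| * `|A' - A| <= 1 / 2 ->
  `|u| <= 2 * p%:R * `|invmx A| * `|A' *m u|.
Proof.
move=> uA hA.
have uE : u = invmx A *m (A' *m u) - invmx A *m ((A' - A) *m u).
  rewrite -mulmxBr -mulmxBl opprB addrC subrK.
  by rewrite mulmxA mulVmx// mul1mx.
have h1 : `|u| <= p%:R * (`|invmx A| * `|A' *m u|) +
    p%:R * (`|invmx A| * (p%:R * (`|A' - A| * `|u|))).
  rewrite {1}uE; apply: le_trans (ler_normB _ _) _.
  apply: lerD; first exact: mx_norm_mul.
  apply: le_trans (mx_norm_mul _ _) _.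
  by rewrite ler_wpM2l// ler_wpM2l// mx_norm_mul.
have h2 : p%:R * (`|invmx A| * (p%:R * (`|A' - A| * `|u|))) <= 1 / 2 * `|u|.
  apply: le_trans (ler_wpM2r (normr_ge0 u) hA).
  by rewrite le_eqVlt; apply/orP; left; apply/eqP; ring.
have {h1 h2} := le_trans h1 (lerD (lexx _) h2).
set x := `|u|; set a := `|invmx A|; set b := `|_ *m _| => h.
have : x - 1 / 2 * x <= p%:R * (a * b) by rewrite lerBlDr.
by move=> {}h; lra.
Qed.

Lemma form_difference (M1 M2 : 'M[R]_p) (u : 'cV[R]_p) :
  `|(u^T *m M1 *m u) 0 0 - (u^T *m M2 *m u) 0 0| <=
  p%:R ^+ 2 * `|M1 - M2| * `|u| ^+ 2.
Proof.
have -> : (u^T *m M1 *m u) 0 0 - (u^T *m M2 *m u) 0 0 =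
    (u^T *m (M1 - M2) *m u) 0 0.
  by rewrite mulmxBr mulmxBl !mxE.
have uT : `|u^T| <= `|u|.
  by apply: mx_norm_le => // i j; rewrite mxE mx_entry_norm.
apply: le_trans (mx_entry_norm _ 0 0) _.
apply: le_trans (mx_norm_mul _ _) _.
apply: (@le_trans _ _ (p%:R * (p%:R * (`|u| * `|M1 - M2|) * `|u|))).
  rewrite ler_wpM2l// ler_wpM2r//; apply: le_trans (mx_norm_mul _ _) _.
  by rewrite ler_wpM2l// ler_wpM2r.
by rewrite le_eqVlt; apply/orP; left; apply/eqP; ring.
Qed.

Definition psd_mx (B : 'M[R]_p) : Prop :=
  B^T = B /\ forall v : 'cV[R]_p, 0 <= (v^T *m B *m v) 0 0.

(** Let a1, a2 be the values of the two forms at u. The equations give a1 = t^2 a2, so (t - 1)(t +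
    1) a2 = a1 - a2, which is at most p^2 |M1 - M2| |u|^2, while |u|^2 <= K a2. Positivity of t
    keeps t + 1 above 1: the sandwich equality is even in t, so without a fixed direction t could
    also tend to -1. *)
Lemma solutions_close (A B : 'M[R]_p) (A1 A2 B1 B2 : nat -> 'M[R]_p)
    (u : nat -> 'cV[R]_p) (t : nat -> R) (c : R) :
  A \in unitmx -> A^T = A -> B \in unitmx ->
  mx_cvg A1 A -> mx_cvg A2 A -> mx_cvg B1 B -> mx_cvg B2 B ->
  (forall n, psd_mx (B1 n)) -> (forall n, psd_mx (B2 n)) ->
  (\forall n \near \oo, [/\ 0 < t n, (A2 n)^T = A2 n,
    B1 n \in unitmx, B2 n \in unitmx &
    (n%:R * ((A1 n *m u n)^T *m invmx (B1 n) *m (A1 n *m u n)) 0 0 = c /\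
     n%:R * ((A2 n *m (t n *: u n))^T *m invmx (B2 n) *m
             (A2 n *m (t n *: u n))) 0 0 = c)]) ->
  Num.sqrt n%:R * (`|t n - 1| * `|u n|) @[n --> \oo] --> 0.
Proof.
move=> uA sA uB cA1 cA2 cB1 cB2 pB1 pB2 hyp.
pose M1 n := (A1 n)^T *m invmx (B1 n) *m A1 n.
pose M2 n := (A2 n)^T *m invmx (B2 n) *m A2 n.
have cM1 : mx_cvg M1 (A^T *m invmx B *m A).
  exact: (mx_cvg_mul (mx_cvg_mul (mx_cvg_tr cA1) (mx_cvg_inv uB cB1)) cA1).
have cM2 : mx_cvg M2 (A^T *m invmx B *m A).
  exact: (mx_cvg_mul (mx_cvg_mul (mx_cvg_tr cA2) (mx_cvg_inv uB cB2)) cA2).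
have cD : `|M1 n - M2 n| @[n --> \oo] --> 0.
  have h : mx_cvg (fun n => M1 n - M2 n) 0.
    move=> i j; rewrite [X in _ --> X]mxE.
    rewrite -[X in _ --> X](subrr ((A^T *m invmx B *m A) i j)).
    rewrite (_ : (fun n => _) = (fun n => M1 n i j - M2 n i j)).
      exact: cvgB (cM1 i j) (cM2 i j).
    by apply/funext => n; rewrite mxE [X in _ + X]mxE.
  have := mx_cvg_norm h; rewrite (_ : (fun n => _) = (fun n => `|M1 n - M2 n|))//.
  by apply/funext => n; rewrite subr0.
pose C := `|B| + 1.
have bB (B_ : nat -> 'M[R]_p) : mx_cvg B_ B -> \forall n \near \oo, `|B_ n| <= C.
  move=> /mx_cvg_norm/cvgrPdist_le/(_ 1 ltr01); apply: filterS => n.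
  rewrite sub0r normrN normr_id => h.
  by have := ler_normD (B_ n - B) B; rewrite subrK /C; move: h; lra.
have bA (A_ : nat -> 'M[R]_p) : mx_cvg A_ A -> \forall n \near \oo,
    p%:R ^+ 2 * `|invmx A| * `|A_ n - A| <= 1 / 2.
  move=> /mx_cvg_norm h.
  have : p%:R ^+ 2 * `|invmx A| * `|A_ n - A| @[n --> \oo] -->
      p%:R ^+ 2 * `|invmx A| * 0.
    by apply: cvgM => //; exact: cvg_cst.
  by rewrite mulr0 => /cvgr_le; apply; lra.
(* Coercivity constant of both forms: the square comes from [norm_le_perturbed], the factor [C] from
   [inv_form_norm]. *)
pose K := (2 * p%:R * `|invmx A|) ^+ 2 * C.
have C0 : 0 <= C by rewrite addr_ge0.
have K0 : 0 <= K by rewrite mulr_ge0// sqr_ge0.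
have key (A_ B_ : 'M[R]_p) (x : 'cV[R]_p) :
    psd_mx B_ -> B_ \in unitmx -> `|B_| <= C ->
    p%:R ^+ 2 * `|invmx A| * `|A_ - A| <= 1 / 2 ->
    `|x| ^+ 2 <= K * ((A_ *m x)^T *m invmx B_ *m (A_ *m x)) 0 0.
  move=> [sB pB] uB_ BC /(norm_le_perturbed x uA) h.
  apply: (@le_trans _ _ ((2 * p%:R * `|invmx A|) ^+ 2 * `|A_ *m x| ^+ 2)).
    by rewrite -exprMn lerXn2r// nnegrE// !mulr_ge0.
  rewrite /K -(mulrA (_ ^+ 2)) ler_wpM2l ?sqr_ge0//; exact: inv_form_norm.
have bound : \forall n \near \oo,
   Num.sqrt n%:R * (`|t n - 1| * `|u n|) <=
   p%:R ^+ 2 * K * Num.sqrt (K * c) * `|M1 n - M2 n|.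
  near=> n.
  have [t0 sA2 uB1 uB2 [e1 e2]] : [/\ 0 < t n, (A2 n)^T = A2 n,
    B1 n \in unitmx, B2 n \in unitmx &
    (n%:R * ((A1 n *m u n)^T *m invmx (B1 n) *m (A1 n *m u n)) 0 0 = c /\
     n%:R * ((A2 n *m (t n *: u n))^T *m invmx (B2 n) *m
             (A2 n *m (t n *: u n))) 0 0 = c)] by near: n.
  have n0 : 0 < n%:R :> R by rewrite ltr0n; near: n; exists 1%N.
  have k1 : `|u n| ^+ 2 <= K * ((A1 n *m u n)^T *m invmx (B1 n) *m (A1 n *m u n)) 0 0.
    by apply: key => //; near: n; [exact: bB|exact: bA].
  have k2 : `|u n| ^+ 2 <= K * ((A2 n *m u n)^T *m invmx (B2 n) *m (A2 n *m u n)) 0 0.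
    by apply: key => //; near: n; [exact: bB|exact: bA].
  have a1E : ((A1 n *m u n)^T *m invmx (B1 n) *m (A1 n *m u n)) 0 0 =
      ((u n)^T *m M1 n *m u n) 0 0 by rewrite /M1 trmx_mul !mulmxA.
  have a2E : ((A2 n *m u n)^T *m invmx (B2 n) *m (A2 n *m u n)) 0 0 =
      ((u n)^T *m M2 n *m u n) 0 0 by rewrite /M2 trmx_mul !mulmxA.
  have e2' : n%:R * (t n ^+ 2 * ((A2 n *m u n)^T *m invmx (B2 n) *m (A2 n *m u n)) 0 0) = c.
    rewrite -e2 -!scalemxAr [(t n *: _)^T]linearZ/= -!scalemxAl scalerA.
    by rewrite [in RHS]mxE expr2.
  have a20 := inv_form_ge0 (A2 n *m u n) uB2 (pB2 n).1 (pB2 n).2.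
  have diff := form_difference (M1 n) (M2 n) (u n).
  rewrite -a1E -a2E in diff.
  move: (normr_ge0 (u n)) k1 k2 e1 e2' a20 diff.
  set x := `|u n|; set a1 := (_ *m _) 0 0; set a2 := (_ *m _) 0 0.
  set D := `|M1 n - M2 n|.
  move=> x0 k1 k2 e1 e2' a20 diff.
  have D0 : 0 <= D by exact: normr_ge0.
  have a12 : a1 = t n ^+ 2 * a2.
    by apply: (mulfI (lt0r_neq0 n0)); rewrite e1 e2'.
  have xc : Num.sqrt n%:R * x <= Num.sqrt (K * c).
    have -> : Num.sqrt n%:R * x = Num.sqrt (n%:R * x ^+ 2).
      by rewrite sqrtrM// sqrtr_sqr ger0_norm.
    apply: ler_wsqrtr; rewrite -e1 [leRHS]mulrCA ler_wpM2l//.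
  have t1 : `|t n - 1| * x <= p%:R ^+ 2 * K * D * x.
    (* The division by a2 fails only if a2 = 0, and then coercivity forces u = 0. *)
    have [a2_eq0|a2_neq0] := eqVneq a2 0.
      have -> : x = 0.
        apply/eqP; rewrite -sqrf_eq0 eq_le sqr_ge0 andbT.
        by rewrite (le_trans k2)// a2_eq0 mulr0.
      by rewrite !mulr0.
    have a2_gt0 : 0 < a2 by rewrite lt_def a2_neq0.
    apply: ler_wpM2r => //.
    rewrite -(ler_pM2r a2_gt0).
    apply: (@le_trans _ _ `|a1 - a2|).
      have -> : a1 - a2 = (t n - 1) * (t n + 1) * a2 by rewrite a12; ring.
      rewrite !normrM (ger0_norm a20) ler_wpM2r//.
      by rewrite ler_peMr// ger0_norm; move: (t0); lra.
    apply: le_trans diff _.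
    rewrite [leRHS](_ : _ = p%:R ^+ 2 * D * (K * a2)); last by ring.
    by rewrite ler_wpM2l// mulr_ge0// sqr_ge0.
  apply: (@le_trans _ _ (p%:R ^+ 2 * K * D * (Num.sqrt n%:R * x))).
    rewrite [leRHS](_ : _ = Num.sqrt n%:R * (p%:R ^+ 2 * K * D * x)); last by ring.
    by rewrite ler_wpM2l// sqrtr_ge0.
  rewrite [leRHS](_ : _ = p%:R ^+ 2 * K * D * Num.sqrt (K * c)); last by ring.
  by rewrite ler_wpM2l// !mulr_ge0// sqr_ge0.
apply: (squeeze_cvgr (f := cst 0)
  (h := fun n => p%:R ^+ 2 * K * Num.sqrt (K * c) * `|M1 n - M2 n|)).
- apply: filterS bound => n ->; rewrite andbT.
  by rewrite mulr_ge0 ?sqrtr_ge0// mulr_ge0.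
- exact: cvg_cst.
- rewrite -[X in _ --> X](mulr0 (p%:R ^+ 2 * K * Num.sqrt (K * c))).
  by apply: cvgM => //; exact: cvg_cst.
Unshelve. all: by end_near. Qed.

End solution_distance.

(** Outside any ball around [t0], compactness gives G a minimum strictly above [G0], out of reach of
    near-minimizers. [G0] is separate from G t0, and [t0] may lie outside S, so that one statement
    serves the maximum likelihood estimator on [Theta] and the pivot solutions on the part of
    [Theta] inside [K]. *)
Lemma argmin_consistent (R : realType) (V : normedModType R) (S : set V)
    (G : V -> R) (t0 : V) (G0 : R) (t : nat -> V) :
  compact S -> {within S, continuous G} ->
  (forall x, S x -> x <> t0 -> G0 < G x) ->
  (\forall n \near \oo, S (t n)) ->
  (forall e, 0 < e -> \forall n \near \oo, G (t n) <= G0 + e) ->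
  t n @[n --> \oo] --> t0.
Proof.
move=> cS cG G0min St Gt; apply/cvgrPdist_lt => e e0.
pose U := S `&` [set x | e <= `|t0 - x|].
have clU : closed [set x | e <= `|t0 - x|].
  apply: (@preimage_closed _ _ (fun x => `|t0 - x|) [set r | e <= r]).
    by move=> x _; apply: cvg_norm; apply: cvgB; [exact: cvg_cst|exact: cvg_id].
  exact: closed_ge.
have cU : compact U by exact: compact_closedI.
have cGU : {within U, continuous G}.
  by apply: continuous_subspaceW cG => x [].
have [U0|U0] := eqVneq U set0.
  apply: filterS St => n Sn; rewrite ltNge; apply/negP => h.
  by have : U (t n) by []; rewrite U0.
have [x xU Gx] := compact_EVT_min ((set0P _).1 U0) cU cGU.
have [Sx ex] : U x by exact: set_mem.
have xt0 : x <> t0.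
  by move=> xt0; move: ex; rewrite /= xt0 subrr normr0 leNgt e0.
have d0 : 0 < (G x - G0) / 2 by rewrite divr_gt0// subr_gt0 G0min.
apply: filterS2 St (Gt _ d0) => n Sn Gn; rewrite ltNge; apply/negP => h.
have : G x <= G (t n) by apply: Gx; apply/mem_set.
by have := G0min x Sx xt0; lra.
Qed.

(** * The statistical model *)

Section empirical.
Context (R : realType) (p : nat) (T : Type) (f : T -> 'cV[R]_p -> R)
  (y : nat -> T).

Lemma mean_scoreE n t i :
  mean_score f y n t i 0 = n%:R^-1 * (\sum_(k < n) score f (y k) t i 0).
Proof. by rewrite mxE summxE. Qed.

Lemma A_empE n t i j :
  A_emp f y n t i j = - (n%:R^-1 * (\sum_(k < n) hessian f (y k) t i j)).
Proof. by rewrite !mxE summxE. Qed.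

Lemma B_empE n t i j :
  B_emp f y n t i j = n%:R^-1 * (\sum_(k < n) score_outer f (y k) t i j).
Proof. by rewrite mxE summxE. Qed.

Lemma score_outerE x t i j :
  score_outer f x t i j = score f x t i 0 * score f x t j 0.
Proof. by rewrite mxE big_ord1 [X in _ * X]mxE. Qed.

Lemma B_emp_psd n t : psd_mx (B_emp f y n t).
Proof.
split.
  apply/matrixP => i j; rewrite mxE !B_empE; congr (_ * _).
  by apply: eq_bigr => k _; rewrite !score_outerE mulrC.
move=> v; rewrite /B_emp -scalemxAr -scalemxAl mxE mulr_ge0 ?invr_ge0//.
rewrite mulmx_sumr mulmx_suml summxE; apply: sumr_ge0 => k _.
rewrite /score_outer; set s := score f (y k) t.
have -> : v^T *m (s *m s^T) *m v = (v^T *m s) *m (v^T *m s)^T.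
  by rewrite trmx_mul trmxK !mulmxA.
by rewrite mxE big_ord1 [X in _ * X]mxE -expr2 sqr_ge0.
Qed.

End empirical.

Section smooth_model.
Context (R : realType) (p : nat) (T : Type) (f : T -> 'cV[R]_p -> R)
  (Theta : set 'cV[R]_p).
Hypothesis smooth : forall y theta, Theta theta -> \forall t \near theta,
  [/\ differentiable (loglik f y) t,
      (forall i, differentiable (fun u => score f y u i 0) t) &
      (forall i j, {for t, continuous (fun u => hessian f y u i j)})].

Lemma smooth_at y t : Theta t ->
  [/\ differentiable (loglik f y) t,
      (forall i, differentiable (fun u => score f y u i 0) t) &
      (forall i j, {for t, continuous (fun u => hessian f y u i j)})].
Proof. by move=> /(smooth y)/nbhs_singleton. Qed.

Lemma hessian_sym y t : Theta t -> (hessian f y t)^T = hessian f y t.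
Proof.
move=> tT; apply/matrixP => i j; rewrite !mxE.
have [_ _ ch] := smooth_at y tT.
have hE k l : (fun u => hessian f y u k l) =
    (fun x => 'D_(delta_mx l 0) (fun u => score f y u k 0) x).
  by apply/funext => u; rewrite mxE.
apply: (@schwarz R p (loglik f y)).
- apply: filterS (smooth y tT) => x [d1 d2 _]; split => //.
  by split; split => //; rewrite mxE.
- by rewrite -hE; exact: ch.
- by rewrite -hE; exact: ch.
Qed.

Lemma within_continuous_at (G : 'cV[R]_p -> R) (S : set 'cV[R]_p) :
  (forall t, S t -> {for t, continuous G}) -> {within S, continuous G}.
Proof.
move=> cG; apply/subspace_continuousP => t St.
by apply: cvg_within_filter; exact: cG.
Qed.

Lemma mean_score_zero (y : nat -> T) n t : Theta° t ->
  is_mle Theta f y n t -> mean_score f y n t = 0.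
Proof.
move=> tT [_ tmax].
apply/matrixP => i j; rewrite ord1 mean_scoreE [RHS]mxE.
suff -> : \sum_(k < n) score f (y k) t i 0 = 0 by rewrite mulr0.
have dl k x : Theta x -> derivable (loglik f (y k)) x (delta_mx i 0).
  by move=> xT; apply: diff_derivable; have [] := smooth_at (y k) xT.
have tT' : Theta t by exact: interior_subset tT.
transitivity ('D_(delta_mx i 0) (\sum_(k < n) loglik f (y k)) t).
  rewrite derive_sum; last by move=> k; exact: dl.
  by apply: eq_bigr => k _; rewrite mxE.
apply: derive_local_max; apply: filterS tT => x xT; split.
  by apply: derivable_sum => k; exact: dl.
by rewrite !fct_sumE; exact: tmax.
Qed.

Lemma mean_score_increment (y : nat -> T) n a b (i : 'I_p) :
  (forall s : R, 0 <= s <= 1 -> Theta (a + s *: (b - a))) ->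
  exists2 s : R, 0 <= s <= 1 &
    mean_score f y n b i 0 - mean_score f y n a i 0 =
    \sum_j (n%:R^-1 * (\sum_(k < n) hessian f (y k) (a + s *: (b - a)) i j)) *
           (b - a) j 0.
Proof.
move=> seg.
pose G := n%:R^-1 \*: (\sum_(k < n) (fun u => score f (y k) u i 0)) : 'cV[R]_p -> R.
have GE u : G u = mean_score f y n u i 0.
  by rewrite mean_scoreE /G/= fct_sumE.
have dsc k x : Theta x -> differentiable (fun u => score f (y k) u i 0) x.
  by move=> xT; have [_ + _] := smooth_at (y k) xT; exact.
have dsum x : Theta x -> differentiable (\sum_(k < n) (fun u => score f (y k) u i 0)) x.
  by move=> xT; apply: differentiable_sum => k; exact: dsc.
have dG x : Theta x -> differentiable G x.
  by move=> xT; apply: differentiableZ; exact: dsum.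
have [s hs Es] : exists2 s : R, 0 <= s <= 1 &
    G (a + (b - a)) - G a = 'D_(b - a) G (a + s *: (b - a)).
  by apply: line_MVT => s hs; apply: dG; exact: seg.
exists s => //; move: Es; rewrite (addrC a (b - a)) subrK !GE => ->.
have xT := seg s hs; set x := a + _ in xT *.
rewrite derive_partials; last exact: dG.
apply: eq_bigr => j _; rewrite mulrC; congr (_ * _).
rewrite /G deriveZ; last by apply: diff_derivable; exact: dsum.
congr (_ * _); rewrite derive_sum; last by move=> k; apply: diff_derivable; exact: dsc.
by apply: eq_bigr => k _; rewrite mxE.
Qed.

End smooth_model.

(** * Deterministic argument along one sample path, given the uniform limits *)

Section sample_path.
Context (R : realType) (p : nat) (T : Type) (f : T -> 'cV[R]_p -> R)
  (Theta K : set 'cV[R]_p) (theta0 : 'cV[R]_p) (y : nat -> T) (c rho : R)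
  (El : 'cV[R]_p -> R) (Es : 'I_p -> 'cV[R]_p -> R)
  (EB EH : 'I_p -> 'I_p -> 'cV[R]_p -> R)
  (that PV SW : nat -> 'cV[R]_p).

(** A ball is convex, unlike [Theta] in general: it contains the segment joining the two estimators,
    along which the score is expanded. *)
Let Bc := [set t : 'cV[R]_p | `|theta0 - t| <= rho].

Hypothesis smooth : forall y theta, Theta theta -> \forall t \near theta,
  [/\ differentiable (loglik f y) t,
      (forall i, differentiable (fun u => score f y u i 0) t) &
      (forall i j, {for t, continuous (fun u => hessian f y u i j)})].
Hypotheses (cTheta : compact Theta) (clK : closed K) (rho0 : 0 < rho)
  (BcTheta : Bc `<=` Theta)
  (cEl : {within Theta, continuous El})
  (cEs : forall i, {within Theta, continuous (Es i)})
  (cEB : forall i j, {within Theta, continuous (EB i j)})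
  (cEH : forall i j, {within Bc, continuous (EH i j)})
  (gl : forall e, 0 < e -> \forall n \near \oo, forall t, Theta t ->
    `|El t - n%:R^-1 * (\sum_(k < n) loglik f (y k) t)| <= e)
  (gs : forall i e, 0 < e -> \forall n \near \oo, forall t, Theta t ->
    `|Es i t - n%:R^-1 * (\sum_(k < n) score f (y k) t i 0)| <= e)
  (gB : forall i j e, 0 < e -> \forall n \near \oo, forall t, Theta t ->
    `|EB i j t - n%:R^-1 * (\sum_(k < n) score_outer f (y k) t i j)| <= e)
  (gH : forall i j e, 0 < e -> \forall n \near \oo, forall t, Bc t ->
    `|EH i j t - n%:R^-1 * (\sum_(k < n) hessian f (y k) t i j)| <= e)
  (El_max : forall t, Theta t -> t <> theta0 -> El t < El theta0)
  (Es_root : forall t, Theta t -> K t -> (forall i, Es i t = 0) -> t = theta0)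
  (uA : \matrix_(i, j) (- EH i j theta0) \in unitmx)
  (uB : \matrix_(i, j) EB i j theta0 \in unitmx)
  (hmle : \forall n \near \oo, is_mle Theta f y n (that n))
  (hPV : \forall n \near \oo, K (PV n) /\ pivot_solution Theta f c y n (PV n))
  (hSW : \forall n \near \oo, sandwich_solution f c y n (that n) (SW n) /\
    same_direction (that n) (PV n) (SW n)).

Let Bc0 : Bc theta0.
Proof. by rewrite /Bc/= subrr normr0 ltW. Qed.

Let Theta0 : Theta theta0.
Proof. exact: BcTheta. Qed.

Lemma mle_cvg : that n @[n --> \oo] --> theta0.
Proof.
have cNEl : {within Theta, continuous (- El)}.
  by move=> t; apply: continuousN; exact: cEl.
apply: (argmin_consistent (G := - El) (G0 := - El theta0) cTheta cNEl).
- by move=> t tT tt0; rewrite !fctE ltrN2 El_max.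
- by apply: filterS hmle => n [].
- move=> e e0; have e20 : 0 < e / 2 by rewrite divr_gt0.
  apply: filterS2 hmle (gl e20) => n [tT tmax] hn; rewrite !fctE.
  have := hn _ tT; have := hn _ Theta0; rewrite !ler_norml.
  have : n%:R^-1 * (\sum_(k < n) loglik f (y k) theta0) <=
         n%:R^-1 * (\sum_(k < n) loglik f (y k) (that n)).
    by rewrite ler_wpM2l ?invr_ge0//; exact: tmax.
  by move=> h /andP[h1 h2] /andP[h3 h4]; lra.
Qed.

Lemma pivot_score_small e : 0 < e ->
  \forall n \near \oo, forall i, `|mean_score f y n (PV n) i 0| <= e.
Proof.
move=> e0; apply: filter_forall => i.
(* The location of [PV n] is not yet known, so the diagonal of [B_emp] must be bounded over all of
   [Theta]: [M] bounds the limit by compactness, and the uniform law adds 1. *)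
have [M hM] : exists M, forall t, Theta t -> EB i i t <= M.
  have T0 : Theta !=set0 by exists theta0.
  have [x _ hx] := compact_EVT_max T0 cTheta (@cEB i i).
  by exists (EB i i x) => t tT; apply: hx; exact: mem_set.
have bnd : \forall n \near \oo, (M + 1) * c <= e ^+ 2 * n%:R.
  exists (Num.truncn (`|(M + 1) * c| / e ^+ 2)).+1 => // n /= hn.
  apply: le_trans (ler_norm _) _.
  rewrite [leRHS]mulrC -ler_pdivrMr ?exprn_gt0//.
  by apply: ltW (lt_le_trans (truncnS_gt _) _); rewrite ler_nat.
near=> n.
have n0 : 0 < n%:R :> R by rewrite ltr0n; near: n; exists 1%N.
have [_ [tT uBn E]] : K (PV n) /\ pivot_solution Theta f c y n (PV n) by near: n.
have [sBn pBn] := B_emp_psd f y n (PV n).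
have q0 := inv_form_ge0 (mean_score f y n (PV n)) uBn sBn pBn.
have := pivot_bound (mean_score f y n (PV n)) i uBn sBn pBn.
set q := (_ *m _) 0 0 in E q0 *; set z := mean_score _ _ _ _ _ _ => hz.
have Bii : B_emp f y n (PV n) i i <= M + 1.
  have h : `|EB i i (PV n) - B_emp f y n (PV n) i i| <= 1.
    by rewrite B_empE; move: (PV n) tT; near: n; exact: gB.
  move: h; rewrite ler_norml => /andP[h1 h2].
  by have := hM _ tT; lra.
have zq : z ^+ 2 <= (M + 1) * q by apply: le_trans hz _; exact: ler_wpM2r.
have : z ^+ 2 <= e ^+ 2.
  rewrite -(ler_pM2r n0); apply: (@le_trans _ _ ((M + 1) * c)).
    by rewrite -E mulrCA (mulrC n%:R) ler_wpM2r.
  by near: n.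
rewrite -(real_normK (num_real z)) ler_pXn2r ?nnegrE// ltW//.
Unshelve. all: by end_near. Qed.

(** The sum of |Es i| vanishes at no point of [Theta] and [K] other than [theta0], and the pivot
    solutions nearly minimize it, since their empirical score is small and uniformly close to
    [Es]. *)
Lemma pivot_cvg : PV n @[n --> \oo] --> theta0.
Proof.
pose G := \sum_i (fun t => `|Es i t|).
have GE t : G t = \sum_i `|Es i t| by rewrite /G fct_sumE.
have cG : {within Theta `&` K, continuous G}.
  rewrite (_ : G = fun t => \sum_i `|Es i t|); last exact/funext.
  apply: (@continuous_subspaceW _ _ _ Theta) => [t []//|].
  apply/subspace_continuousP => t tT.
  have cE i : Es i u @[u --> within Theta (nbhs t)] --> Es i t.
    by have /subspace_continuousP/(_ t tT) := @cEs i.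
  suff : \sum_i `|Es i u| @[u --> within Theta (nbhs t)] --> \sum_i `|Es i t|.
    by [].
  elim: (index_enum _) => [|i r ih].
    by rewrite big_nil; under eq_fun do rewrite big_nil; exact: cvg_cst.
  rewrite big_cons; under eq_fun do rewrite big_cons.
  by apply: cvgD ih; apply: cvg_norm; exact: cE.
apply: (argmin_consistent (G0 := 0) (compact_closedI cTheta clK) cG).
- move=> t [tT tK] tt0; rewrite GE lt_def sumr_ge0// andbT.
  apply/negP => /eqP/psumr_eq0P h; apply: tt0; apply: Es_root => // i.
  by apply/eqP; rewrite -normr_eq0 h.
- by apply: filterS hPV => n [Kn [Tn _ _]].
(* Each of the p coordinates contributes at most 2d; p + 1 in the denominator avoids a division by
   zero. *)
- move=> e e0; rewrite add0r; pose d := e / (2 * p.+1%:R).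
  have d0 : 0 < d by rewrite divr_gt0// mulr_gt0.
  have hs : \forall n \near \oo, forall i t, Theta t ->
      `|Es i t - n%:R^-1 * (\sum_(k < n) score f (y k) t i 0)| <= d.
    by apply: filter_forall => i; exact: gs.
  apply: filterS3 (pivot_score_small d0) hs hPV => n h1 h2 [_ [tT _ _]].
  rewrite GE; apply: (@le_trans _ _ (\sum_(i < p) (d + d))).
    apply: ler_sum => i _.
    have := h2 i _ tT; have := h1 i; rewrite mean_scoreE.
    set a := Es _ _; set b := _ * _ => hb hab.
    by rewrite -(subrK b a) (le_trans (ler_normD _ _))// lerD.
  rewrite sumr_const card_ord -mulr_natr.
  have -> : e = (d + d) * p.+1%:R by rewrite /d; field; rewrite nat1r pnatr_eq0.
  by rewrite ler_wpM2l ?ler_nat// addr_ge0// ltW.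
Qed.

Let A := \matrix_(i, j) (- EH i j theta0).
Let B := \matrix_(i, j) EB i j theta0.

Let near_Bc (t : nat -> 'cV[R]_p) : t n @[n --> \oo] --> theta0 ->
  \forall n \near \oo, Bc (t n).
Proof. by move=> /cvgrPdist_le/(_ _ rho0). Qed.

Let interior_Theta t : `|theta0 - t| < rho -> Theta° t.
Proof.
move=> h; have : ball theta0 rho t by rewrite -ball_normE.
have := @ball_open _ _ theta0 rho; rewrite openE => /[apply].
apply: filterS => u; rewrite -ball_normE/= => hu; apply: BcTheta.
exact: ltW.
Qed.

Lemma B_emp_cvg (t : nat -> 'cV[R]_p) : t n @[n --> \oo] --> theta0 ->
  (\forall n \near \oo, Theta (t n)) -> mx_cvg (fun n => B_emp f y n (t n)) B.
Proof.
move=> tt Tt i j; rewrite [X in _ --> X]mxE; under eq_fun do rewrite B_empE.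
exact: (@uniform_cvg_at _ _ _ (fun n t => n%:R^-1 *
  (\sum_(k < n) score_outer f (y k) t i j)) _ _ _ (@cEB i j) (@gB i j) Theta0 Tt tt).
Qed.

Lemma mean_hessian_cvg (t : nat -> 'cV[R]_p) i j : t n @[n --> \oo] --> theta0 ->
  - (n%:R^-1 * (\sum_(k < n) hessian f (y k) (t n) i j)) @[n --> \oo] --> A i j.
Proof.
move=> tt; rewrite [X in _ --> X]mxE; apply: cvgN.
exact: (@uniform_cvg_at _ _ _ (fun n t => n%:R^-1 *
  (\sum_(k < n) hessian f (y k) t i j)) _ _ _ (@cEH i j) (@gH i j) Bc0
  (near_Bc tt) tt).
Qed.

Lemma A_emp_cvg : mx_cvg (fun n => A_emp f y n (that n)) A.
Proof.
move=> i j; under eq_fun do rewrite A_empE.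
exact: mean_hessian_cvg mle_cvg.
Qed.

Lemma A_emp_sym n t : Theta t -> (A_emp f y n t)^T = A_emp f y n t.
Proof.
move=> tT; apply/matrixP => i j; rewrite mxE !A_empE; congr (- (_ * _)).
apply: eq_bigr => k _.
by rewrite -[in RHS](hessian_sym smooth (y k) tT) [RHS]mxE.
Qed.

Lemma A_limit_sym : A^T = A.
Proof.
apply/matrixP => i j; rewrite mxE.
have h1 := @A_emp_cvg i j; have h2 := @A_emp_cvg j i.
suff h3 : A_emp f y n (that n) j i @[n --> \oo] --> A i j.
  exact: (cvg_unique _ h2 h3).
apply: cvg_trans h1; apply: near_eq_cvg.
apply: filterS (near_Bc mle_cvg) => n /BcTheta tT.
by rewrite -[in LHS](A_emp_sym n tT) [LHS]mxE.
Qed.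

(* Each coordinate of the score has its own intermediate point, so A1 n is not
   an empirical Hessian A_emp evaluated at one parameter. *)
Lemma score_expansion : exists2 A1 : nat -> 'M[R]_p, mx_cvg A1 A &
  \forall n \near \oo, mean_score f y n (PV n) = - (A1 n *m (PV n - that n)).
Proof.
have seg n : exists s : 'I_p -> R, (forall i, 0 <= s i <= 1) /\
    (`|theta0 - that n| < rho -> `|theta0 - PV n| < rho -> forall i,
     mean_score f y n (PV n) i 0 - mean_score f y n (that n) i 0 =
     \sum_j (n%:R^-1 * (\sum_(k < n) hessian f (y k)
       (that n + s i *: (PV n - that n)) i j)) * (PV n - that n) j 0).
  (* Intermediate points are required for every n; when an estimator is outside the ball, 0 is a
     placeholder. *)
  have [[h1 h2]|h] := pselect (`|theta0 - that n| < rho /\ `|theta0 - PV n| < rho);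
    last first.
    exists (fun=> 0); split; first by move=> i; rewrite lexx ler01.
    by move=> h1 h2; exfalso; apply: h.
  have hseg (s : R) : 0 <= s <= 1 -> Theta (that n + s *: (PV n - that n)).
    move=> /andP[s0 s1]; apply: BcTheta; rewrite /Bc/=.
    have -> : theta0 - (that n + s *: (PV n - that n)) =
        (1 - s) *: (theta0 - that n) + s *: (theta0 - PV n).
      by apply/matrixP => i j; rewrite !mxE; ring.
    apply: le_trans (ler_normD _ _) _; rewrite !normrZ (ger0_norm s0).
    rewrite ger0_norm ?subr_ge0//.
    have -> : rho = (1 - s) * rho + s * rho by ring.
    by rewrite lerD// ler_wpM2l ?subr_ge0// ltW.
  have := fun i => @mean_score_increment _ _ _ _ _ smooth y n (that n) (PV n) i hseg.
  move=> /(_ _)/cid2-/all_sig2[s hs1 hs2].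
  by exists s; split.
have [s hs] := choice seg.
exists (fun n => \matrix_(i, j) (- (n%:R^-1 * (\sum_(k < n) hessian f (y k)
    (that n + s n i *: (PV n - that n)) i j)))).
  move=> i j; under eq_fun do rewrite mxE.
  apply: mean_hessian_cvg.
  apply/cvgrPdist_le => e e0; have e20 : 0 < e / 2 by rewrite divr_gt0.
  have /cvgrPdist_le/(_ _ e20) h1 := mle_cvg.
  have h2 : PV n - that n @[n --> \oo] --> (0 : 'cV[R]_p).
    rewrite -[X in _ --> X](subrr theta0).
    by apply: cvgB; [exact: pivot_cvg|exact: mle_cvg].
  move/cvgrPdist_le : h2 => /(_ _ e20) h2.
  apply: filterS2 h1 h2 => n h1; rewrite sub0r normrN => h2.
  have [/(_ i)/andP[s0 s1] _] := hs n.
  rewrite opprD addrA (splitr e) (le_trans (ler_normB _ _))// lerD//.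
  rewrite normrZ (ger0_norm s0) (le_trans _ h2)//.
  by rewrite ler_piMl.
have /cvgrPdist_lt/(_ _ rho0) h1 := mle_cvg.
have /cvgrPdist_lt/(_ _ rho0) h2 := pivot_cvg.
apply: filterS3 h1 h2 hmle => n h1 h2 hm.
have s0 : mean_score f y n (that n) = 0.
  exact: (mean_score_zero smooth (interior_Theta h1) hm).
apply/matrixP => i j; rewrite ord1.
have [_ /(_ h1 h2 i)] := hs n; rewrite s0 [X in _ - X]mxE subr0 => ->.
rewrite -mulNmx [RHS]mxE; apply: eq_bigr => k _; congr (_ * _).
by rewrite [RHS]mxE [X in _ = - X]mxE opprK.
Qed.

Lemma pivot_sandwich_close :
  Num.sqrt n%:R * enorm (PV n - SW n) @[n --> \oo] --> 0.
Proof.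
have [A1 cA1 eA1] := score_expansion.
(* The ratio t must be a total function of n; the value 0 stands in wherever the direction condition
   fails, which by [hSW] concerns only finitely many n. *)
have exdir n : exists t : R, same_direction (that n) (PV n) (SW n) ->
    0 < t /\ SW n - that n = t *: (PV n - that n).
  have [[t t0 tE]|h] := pselect (same_direction (that n) (PV n) (SW n)).
    by exists t.
  by exists 0 => /h.
have [t ht] := choice exdir.
have T1 : \forall n \near \oo, Theta (PV n) by apply: filterS hPV => n [_ []].
have T2 : \forall n \near \oo, Theta (that n) by apply: filterS hmle => n [].
have close := @solutions_close R p A B A1 (fun n => A_emp f y n (that n))
  (fun n => B_emp f y n (PV n)) (fun n => B_emp f y n (that n))
  (fun n => PV n - that n) t c uA A_limit_sym uB cA1 A_emp_cvg
  (B_emp_cvg pivot_cvg T1) (B_emp_cvg mle_cvg T2)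
  (fun n => B_emp_psd f y n (PV n)) (fun n => B_emp_psd f y n (that n)).
have {}close : Num.sqrt n%:R * (`|t n - 1| * `|PV n - that n|) @[n --> \oo] --> 0.
  apply: close; near=> n.
  have [_ [_ uB1 ePV]] : K (PV n) /\ pivot_solution Theta f c y n (PV n) by near: n.
  have [[uB2 eSW] dir] : sandwich_solution f c y n (that n) (SW n) /\
    same_direction (that n) (PV n) (SW n) by near: n.
  have [t0 tE] := ht n dir.
  have sA : (A_emp f y n (that n))^T = A_emp f y n (that n).
    by apply: A_emp_sym; near: n.
  have eS : mean_score f y n (PV n) = - (A1 n *m (PV n - that n)) by near: n.
  split => //; split.
    by rewrite -ePV eS [(- _)^T]raddfN/= mulNmx mulNmx mulmxN opprK.
  have E : that n - SW n = - (t n *: (PV n - that n)) by rewrite -tE opprB.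
  have trN m k (X : 'M[R]_(m, k)) : (- X)^T = - X^T.
    by apply/matrixP => i j; rewrite !mxE.
  rewrite -eSW E; move: (A_emp f y n (that n)) sA => M sA.
  by rewrite trN !mulNmx mulmxN opprK trmx_mul sA !mulmxA.
have bound : \forall n \near \oo, Num.sqrt n%:R * enorm (PV n - SW n) <=
    Num.sqrt p%:R * (Num.sqrt n%:R * (`|t n - 1| * `|PV n - that n|)).
  apply: filterS hSW => n [_ /(ht n)[_ tE]].
  rewrite mulrCA ler_wpM2l ?sqrtr_ge0//.
  (* From SW - that = t (PV - that) it follows that PV - SW = (1 - t)(PV - that). *)
  have -> : `|t n - 1| * `|PV n - that n| = `|PV n - SW n|.
    rewrite -normrZ scalerBl scale1r -tE opprB addrA subrK.
    by rewrite distrC.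
  exact: enorm_le.
apply: (squeeze_cvgr (f := cst 0) (h := fun n => Num.sqrt p%:R *
    (Num.sqrt n%:R * (`|t n - 1| * `|PV n - that n|)))).
- apply: filterS bound => n ->; rewrite andbT.
  by rewrite mulr_ge0// ?sqrtr_ge0.
- exact: cvg_cst.
- rewrite -[X in _ --> X](mulr0 (Num.sqrt p%:R)).
  by apply: cvgM => //; exact: cvg_cst.
Unshelve. all: by end_near. Qed.

End sample_path.

(* (A4) only makes the score measurable, and only on Theta: at interior points
   the Hessian is a limit of difference quotients taken inside Theta. *)
Lemma measurable_hessian (R : realType) (p : nat) (d : measure_display)
    (T : measurableType d) (Theta : set 'cV[R]_p) (f : T -> 'cV[R]_p -> R) t i j :
  cond_A4 Theta f -> Theta° t -> measurable_fun setT (fun y => hessian f y t i j).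
Proof.
move=> [msc smooth] tT.
have /nbhs_ballP[r r0 hr] := tT.
pose e : 'cV[R]_p := delta_mx j 0.
(* Starting the steps 1 / (k + 1) at [N] keeps h k |e| below r, so every difference quotient
   evaluates the score inside [Theta]. *)
pose N := Num.truncn ((`|e| + 1) / r).
pose h k : R := (k + N)%N.+1%:R^-1.
have h0 k : 0 < h k by rewrite invr_gt0.
have e0 : 0 < `|e| + 1 by rewrite ltr_wpDl.
have Th k : Theta (h k *: e + t).
  apply: hr; rewrite -ball_normE/= opprD addrCA subrr addr0 normrN normrZ.
  rewrite gtr0_norm//; apply: (@lt_le_trans _ _ (h k * (`|e| + 1))).
    by rewrite ltr_pM2l// ltrDl.
  rewrite /h mulrC ler_pdivrMr// mulrC -ler_pdivrMr//.
  apply: ltW (lt_le_trans (truncnS_gt _) _).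
  by rewrite ler_nat ltnS leq_addl.
have hcvg : h k @[k --> \oo] --> 0.
  by have := @cvg_harmonic R; rewrite -(cvg_shiftn N).
have hcvg' : h k @[k --> \oo] --> 0^'.
  move=> D; rewrite /dnbhs/within => hD.
  have hD2 : \forall k \near \oo, h k != 0 -> D (h k) := hcvg _ hD.
  change (\forall k \near \oo, D (h k)).
  by apply: filterS hD2 => k; apply; exact: lt0r_neq0.
have tT' : Theta t by exact: interior_subset tT.
pose u k y : R := (h k)^-1 * (score f y (h k *: e + t) i 0 - score f y t i 0).
have mu_ k : measurable_fun setT (u k).
  apply: measurable_funM; first exact: measurable_cst.
  by apply: measurable_funB; apply: msc.
apply: (measurable_fun_cvg mu_) => y _; rewrite [X in _ --> X]mxE.
have [_ ds _] := nbhs_singleton (smooth y t tT').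
have dd : derivable (fun u => score f y u i 0) t e by exact: diff_derivable.
have hh := cvg_comp _ _ hcvg' dd.
exact: hh.
Qed.

Lemma integrable_under_dominated (R : realType) (d : measure_display)
    (T : measurableType d) (nu : {measure set T -> \bar R}) (g phi h : T -> R) :
  measurable_fun setT g -> (forall y, 0 <= g y) -> measurable_fun setT phi ->
  (forall y, `|phi y| <= h y) -> integrable_under nu g h ->
  integrable_under nu g phi.
Proof.
move=> mg g0 mphi phih [mh ih]; split => //.
apply: le_integrable ih => //.
  by apply/measurable_EFinP; exact: measurable_funM.
move=> y _ /=; rewrite lee_fin !normrM ler_wpM2r//.
by rewrite (le_trans (phih y))// ler_norm.
Qed.

Lemma integrable_under_law (R : realType) (d d' : measure_display)
    (Om : measurableType d) (P : probability Om R) (T : measurableType d')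
    (Y : nat -> {RV P >-> T}) (nu : {measure set T -> \bar R}) (g phi : T -> R) :
  cond_A1 Y nu g -> integrable_under nu g phi ->
  (distribution P (Y 0%N)).-integrable setT (EFin \o phi) /\
  \int[distribution P (Y 0%N)]_y phi y = expect nu g phi.
Proof.
move=> [_ mg g0 law] [mphi iphi].
have muE : forall B, measurable B ->
  distribution P (Y 0%N) B = (\int[nu]_(y in B) (g y)%:E)%E by exact: law.
split; first exact: (integrable_density mg g0 muE mphi iphi).
exact: (Rintegral_density mg g0 muE mphi iphi).
Qed.

Theorem theorem1 (R : realType) (p : nat) (hp : (0 < p)%N)
    (d d' : measure_display) (Om : measurableType d) (P : probability Om R)
    (T : measurableType d') (Y : nat -> {RV P >-> T})
    (nu : {measure set T -> \bar R}) (g : T -> R)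
    (Theta : set 'cV[R]_p) (f : T -> 'cV[R]_p -> R) (theta0 : 'cV[R]_p)
    (alpha : R) (halpha : 0 < alpha < 1)
    (hA1 : cond_A1 Y nu g)
    (hA2 : cond_A2 nu Theta f)
    (hA3 : cond_A3 nu g Theta f theta0)
    (hA4 : cond_A4 Theta f)
    (hA5 : cond_A5 nu g Theta f)
    (hA6 : cond_A6 nu g Theta f theta0)
    (K : set 'cV[R]_p) (hK : no_spurious_root nu g Theta f theta0 K)
    (that thetaPV thetaSW : nat -> Om -> 'cV[R]_p)
    (hmle : {ae P, forall w, \forall n \near \oo,
       is_mle Theta f (fun i => Y i w) n (that n w)})
    (hPV : {ae P, forall w, \forall n \near \oo,
       K (thetaPV n w) /\
       pivot_solution Theta f (chi2_quantile p (1 - alpha))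
         (fun i => Y i w) n (thetaPV n w)})
    (hSW : {ae P, forall w, \forall n \near \oo,
       sandwich_solution f (chi2_quantile p (1 - alpha))
         (fun i => Y i w) n (that n w) (thetaSW n w) /\
       same_direction (that n w) (thetaPV n w) (thetaSW n w)}) :
  {ae P, forall w,
     (Num.sqrt n%:R * enorm (thetaPV n w - thetaSW n w)) @[n --> \oo] --> 0}.
Proof.
have iidY := cond_A1_pairwise_iid hA1.
pose mu := distribution P (Y 0%N).
have [_ mg g0 lawY] := hA1.
have [cTheta hf _] := hA2.
have [ilng [m im hm] Theta0 KLmin] := hA3.
have [msc smooth] := hA4.
have [intTheta uB _ rankA] := hA6.
have [clK root] := hK.
have law (phi : T -> R) : integrable_under nu g phi ->
    mu.-integrable setT (EFin \o phi) /\
    \int[mu]_y phi y = expect nu g phi.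
  exact: integrable_under_law hA1.
have dom (phi h : T -> R) : measurable_fun setT phi -> (forall y, `|phi y| <= h y) ->
    integrable_under nu g h -> integrable_under nu g phi.
  exact: integrable_under_dominated mg g0.
(* Half the radius of an open ball, so that the closed ball is still interior to [Theta]. *)
have [rho rho0 hrho] : exists2 rho : R, 0 < rho &
    forall t, `|theta0 - t| <= rho -> Theta° t.
  have /nbhs_ballP[r r0 hr] := intTheta.
  exists (r / 2); first by rewrite divr_gt0.
  move=> t ht; have bt : ball theta0 r t.
    by rewrite -ball_normE/= (le_lt_trans ht)// ltr_pdivrMr// mulr_natr mulr2n ltrDl.
  have := @ball_open _ _ theta0 r; rewrite openE => /(_ t bt).
  by apply: filterS.
pose Bc := [set t : 'cV[R]_p | `|theta0 - t| <= rho].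
have BcTheta : Bc `<=` Theta by move=> t /hrho; exact: interior_subset.
have cBc : compact Bc.
  apply: subclosed_compact cTheta BcTheta.
  have -> : Bc = closed_ball theta0 rho by rewrite closed_ballE.
  exact: closed_ball_closed.
have ml t : Theta t -> measurable_fun setT (loglik f ^~ t).
  by move=> /hf[_ mft _]; apply: measurableT_comp => //; exact: measurable_ln.
have ms t i : Theta t -> measurable_fun setT (fun y => score f y t i 0).
  by move=> tT; exact: msc.
have mo t i j : Theta t -> measurable_fun setT (fun y => score_outer f y t i j).
  move=> tT; rewrite (_ : (fun y => _) = (fun y => score f y t i 0 * score f y t j 0)).
    by apply: measurable_funM; exact: ms.
  by apply/funext => y; exact: score_outerE.
have mh t i j : Bc t -> measurable_fun setT (fun y => hessian f y t i j).
  by move=> /hrho; exact: measurable_hessian hA4.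
have add (phi h : T -> R) : integrable_under nu g phi -> integrable_under nu g h ->
    integrable_under nu g (fun y => phi y + h y).
  move=> [mphi iphi] [mh' ih]; split; first exact: measurable_funD.
  apply: eq_integrable (integrableD measurableT iphi ih) => //.
  by move=> y _ /=; rewrite -EFinD mulrDl.
(* The density g has total mass 1, being the law of [Y 0]; the constant 1 enters the dominating
   function of the score. *)
have i1 : integrable_under nu g (fun=> 1).
  split; first exact: measurable_cst.
  apply/integrableP; split.
    by apply/measurable_EFinP; apply: measurable_funM => //; exact: measurable_cst.
  have := lawY 0%N setT measurableT; rewrite preimage_setT probability_setT => hg.
  apply: (@le_lt_trans _ _ (\int[nu]_y (g y)%:E)%E); last by rewrite -hg ltry.
  rewrite le_eqVlt; apply/orP; left; apply/eqP; apply: eq_integral => y _.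
  by rewrite /= mul1r ger0_norm.
have cl y : {within Theta, continuous (loglik f y)}.
  apply: within_continuous_at => t tT; have [dl _ _] := smooth_at smooth y tT.
  exact: differentiable_continuous.
have cs i y : {within Theta, continuous (fun t => score f y t i 0)}.
  apply: within_continuous_at => t tT; have [_ ds _] := smooth_at smooth y tT.
  exact: differentiable_continuous.
have co i j y : {within Theta, continuous (fun t => score_outer f y t i j)}.
  rewrite (_ : (fun t => _) = (fun t => score f y t i 0 * score f y t j 0)).
    by move=> t; apply: continuousM; exact: cs.
  by apply/funext => t; exact: score_outerE.
have ch i j y : {within Bc, continuous (fun t => hessian f y t i j)}.
  apply: within_continuous_at => t /BcTheta tT.
  by have [_ _ +] := smooth_at smooth y tT; exact.
have bl y t : Theta t -> `|loglik f y t| <= m y by move=> /(hm y)[].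
(* (A5) dominates s^2 for each score component s, and |s| <= 1 + s^2. *)
have bs i : exists2 h, integrable_under nu g h &
    forall y t, Theta t -> `|score f y t i 0| <= h y.
  have [_ [h ih hh]] := hA5 i i; exists (fun y => 1 + h y); first exact: add.
  move=> y t tT; have := hh y t tT; rewrite score_outerE.
  set s := score _ _ _ _ _; rewrite -expr2 normrX => h1.
  apply: le_trans (lerD (lexx 1) h1).
  by have := sqr_ge0 (`|s| - 1); rewrite sqrrB1; have := normr_ge0 s; lra.
have ul := ulln iidY cTheta ml cl (law _ im).1 bl.
have us i : {ae P, forall w (e : R), 0 < e ->
    \forall n \near \oo, forall t, Theta t ->
    `|\int[mu]_y score f y t i 0 -
      n%:R^-1 * (\sum_(k < n) score f (Y k w) t i 0)| <= e}.
  have [h ih hh] := bs i.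
  exact: (ulln iidY (F := fun y t => score f y t i 0) cTheta (fun t => ms t i)
    (cs i) (law _ ih).1 hh).
have uo i j : {ae P, forall w (e : R), 0 < e ->
    \forall n \near \oo, forall t, Theta t ->
    `|\int[mu]_y score_outer f y t i j -
      n%:R^-1 * (\sum_(k < n) score_outer f (Y k w) t i j)| <= e}.
  have [_ [h ih hh]] := hA5 i j.
  exact: (ulln iidY (F := fun y t => score_outer f y t i j) cTheta
    (fun t => mo t i j) (co i j) (law _ ih).1 hh).
have uh i j : {ae P, forall w (e : R), 0 < e ->
    \forall n \near \oo, forall t, Bc t ->
    `|\int[mu]_y hessian f y t i j -
      n%:R^-1 * (\sum_(k < n) hessian f (Y k w) t i j)| <= e}.
  have [[h ih hh] _] := hA5 i j.
  exact: (ulln iidY (F := fun y t => hessian f y t i j) cBc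
    (fun t => mh t i j) (ch i j) (law _ ih).1 (fun y t tB => hh y t (BcTheta t tB))).
have e_hess i j t : Bc t -> \int[mu]_y hessian f y t i j =
    expect nu g (fun y => hessian f y t i j).
  move=> tB; have [[h ih hh] _] := hA5 i j; apply: (law _ _).2.
  by apply: dom ih; [exact: mh|move=> y; exact/hh/BcTheta].
have e_outer i j : \int[mu]_y score_outer f y theta0 i j =
    expect nu g (fun y => score_outer f y theta0 i j).
  have [_ [h ih hh]] := hA5 i j; apply: (law _ _).2.
  by apply: dom ih; [exact: mo|move=> y; exact: hh].
have e_score i t : Theta t -> \int[mu]_y score f y t i 0 =
    expect nu g (fun y => score f y t i 0).
  move=> tT; have [h ih hh] := bs i; apply: (law _ _).2.
  by apply: dom ih; [exact: ms|move=> y; exact: hh].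
have Bc0 : Bc theta0 by rewrite /Bc/= subrr normr0 ltW.
(* Both logarithms are integrable under g, so the divergence splits and its minimizer is the
   maximizer of the expected log-likelihood. *)
have KLE t : Theta t -> KL nu g f t =
    \int[mu]_y ln (g y) - \int[mu]_y loglik f y t.
  move=> tT; have il : integrable_under nu g (loglik f ^~ t).
    by apply: dom im; [exact: ml|move=> y; exact: bl].
  have iNl : integrable_under nu g (fun y => ln (g y) - loglik f y t).
    apply: add => //; apply: dom im; first by apply: measurable_funN; exact: ml.
    by move=> y; rewrite normrN; exact: bl.
  rewrite /KL -(law _ iNl).2 RintegralB//; [exact: (law _ ilng).1|exact: (law _ il).1].
have El_max t : Theta t -> t <> theta0 ->
    \int[mu]_y loglik f y t < \int[mu]_y loglik f y theta0.
  by move=> tT /(KLmin t tT); rewrite !KLE// ltrD2l ltrN2.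
have Es_root t : Theta t -> K t -> (forall i, \int[mu]_y score f y t i 0 = 0) ->
    t = theta0.
  move=> tT tK h; apply: root => //; apply/matrixP => i j.
  by rewrite !mxE -e_score.
have uA : \matrix_(i, j) (- \int[mu]_y hessian f y theta0 i j) \in unitmx.
  rewrite (_ : \matrix_(i, j) _ = A_pop nu g f theta0).
    by rewrite -row_free_unit /row_free rankA.
  by apply/matrixP => i j; rewrite !mxE e_hess.
have uB' : \matrix_(i, j) (\int[mu]_y score_outer f y theta0 i j) \in unitmx.
  rewrite (_ : \matrix_(i, j) _ = B_pop nu g f theta0)//.
  by apply/matrixP => i j; rewrite !mxE e_outer.
(* The indices i and j range over finite sets, so all exceptional sets merge into one; outside it a
   single path satisfies every hypothesis of [pivot_sandwich_close]. *)
have aeF := ae_filter_ringOfSetsType P.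
have aeus := filter_forall aeF us.
have aeuo := filter_forall aeF (fun i => filter_forall aeF (uo i)).
have aeuh := filter_forall aeF (fun i => filter_forall aeF (uh i)).
apply: filter_app hSW; apply: filter_app hPV; apply: filter_app hmle.
apply: filter_app aeuh; apply: filter_app aeuo.
apply: filterS2 ul aeus => w gl gs gB gH hmw hPVw hSWw.
apply: (@pivot_sandwich_close R p T f Theta K theta0 (fun k => Y k w)
  (chi2_quantile p (1 - alpha)) rho (fun t => \int[mu]_y loglik f y t)
  (fun i t => \int[mu]_y score f y t i 0)
  (fun i j t => \int[mu]_y score_outer f y t i j)
  (fun i j t => \int[mu]_y hessian f y t i j)
  (that ^~ w) (thetaPV ^~ w) (thetaSW ^~ w) smooth cTheta clK rho0 BcTheta) => //.
- exact: (integral_within_continuous cTheta ml cl (law _ im).1 bl).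
- move=> i; have [h ih hh] := bs i.
  exact: (integral_within_continuous (F := fun y t => score f y t i 0) cTheta
    (fun t => ms t i) (cs i) (law _ ih).1 hh).
- move=> i j; have [_ [h ih hh]] := hA5 i j.
  exact: (integral_within_continuous (F := fun y t => score_outer f y t i j) cTheta
    (fun t => mo t i j) (co i j) (law _ ih).1 hh).
- move=> i j; have [[h ih hh] _] := hA5 i j.
  exact: (integral_within_continuous (F := fun y t => hessian f y t i j) cBc
    (fun t => mh t i j) (ch i j) (law _ ih).1 (fun y t tB => hh y t (BcTheta t tB))).
Qed.
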